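(* Let $X_1, X_2, \ldots$ be independent and identically distributed real random variables with mean zero, variance $\sigma^2 > 0$ and $\mathbb{E}|X_1|^r < \infty$ for some $r \geq 2$. Let $Z_{\sigma^2}$ denote a $N(0,\sigma^2)$ random variable. If $S_n = (X_1 + \ldots + X_n)/\sqrt{n}$, then $$\lim_{n \to \infty} d_r(S_n, Z_{\sigma^2}) = 0.$$
   Context: For $r>0$, the Mallows $r$-distance between probability distribution functions $F_X$ and $F_Y$ on $\mathbb{R}$ is $d_r(F_X,F_Y) = \left( \inf_{(X,Y)} \mathbb{E}|X-Y|^r \right)^{1/r}$, where the infimum is taken over pairs $(X,Y)$ of random variables (on a common probability space) whose marginal distribution functions are $F_X$ and $F_Y$ respectively; it may be infinite. One writes $d_r(X,Y)$ for $d_r(F_X,F_Y)$, so that $d_r(X,Y)$ depends only on the marginal laws of $X$ and $Y$. *)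

(* Defs.v *)
From HB Require Import structures.
From mathcomp Require Import all_boot all_order all_algebra.
From mathcomp Require Import finmap.
From mathcomp Require Import all_classical all_reals all_analysis.
From mathcomp Require Import measurable_realfun.

Set Implicit Arguments.
Unset Strict Implicit.
Unset Printing Implicit Defensive.

Import Order.TTheory GRing.Theory Num.Theory.
Import numFieldNormedType.Exports.

Local Open Scope classical_set_scope.
Local Open Scope ring_scope.
Local Open Scope ereal_scope.

(* Meaningful for r > 0, in which case the value is +oo when F and G have no
   coupling or only couplings of infinite cost. *)
Definition mallows_dist (R : realType) (r : R) (F G : R -> \bar R) : \bar R :=
  (ereal_inf [set c | exists (d : measure_display) (T : measurableType d)
      (P : probability T R) (X Y : {RV P >-> R}),
      [/\ cdf X = F, cdf Y = G & c = 'E_P[fun w => (`|X w - Y w| `^ r)%R]]])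
  `^ r^-1.

Definition mallows d (T : measurableType d) d' (T' : measurableType d')
    (R : realType) (P : probability T R) (Q : probability T' R) (r : R)
    (X : {RV P >-> R}) (Y : {RV Q >-> R}) : \bar R :=
  mallows_dist r (cdf X) (cdf Y).

Definition same_distribution d (T : measurableType d) d' (T' : measurableType d')
    (R : realType) (P : probability T R) (Q : probability T' R)
    (X : {RV P >-> R}) (Y : {RV Q >-> R}) : Prop :=
  forall A : set R, measurable A -> distribution P X A = distribution Q Y A.

Definition mutually_independent d (T : measurableType d) (R : realType)
    (P : probability T R) (X : nat -> {RV P >-> R}) : Prop :=
  forall (J : {fset nat}) (A : nat -> set R),
    (forall i, i \in J -> measurable (A i)) ->
    P (\bigcap_(i in [set` J]) (X i @^-1` A i))
    = \prod_(i <- J) P (X i @^-1` A i).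

Definition iid d (T : measurableType d) (R : realType)
    (P : probability T R) (X : nat -> {RV P >-> R}) : Prop :=
  mutually_independent X /\ forall i, same_distribution (X i) (X 0%N).

(* [normal_prob m s] is parametrised by the standard deviation [s]. *)
Definition is_normal d (T : measurableType d) (R : realType)
    (P : probability T R) (m s : R) (Z : {RV P >-> R}) : Prop :=
  forall A : set R, measurable A -> distribution P Z A = normal_prob m s A.

Section normalized_sum.
Context d (T : measurableType d) (R : realType) (P : probability T R).
Variables (X : nat -> {RV P >-> R}) (n : nat).

(* X_1, X_2, ... are numbered from 0 here, so X_1 + ... + X_n is the sum over
   i < n. *)
Definition normalized_sum_fun (w : T) : R :=
  ((\sum_(i < n) X i w) / Num.sqrt n%:R)%R.

Let measurable_normalized_sum_fun : measurable_fun setT normalized_sum_fun.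
Proof.
apply: measurable_funM => //; apply: measurable_sum => i.
exact: measurable_funPT.
Qed.

HB.instance Definition _ := isMeasurableFun.Build _ _ _ _ normalized_sum_fun
  measurable_normalized_sum_fun.

Definition normalized_sum : {RV P >-> R} := normalized_sum_fun.

End normalized_sum.

(* Main.v *)
(** For smooth bounded g, the expectations of g along S_n and along the normal
    law are compared by replacing the X_i one at a time by normal variables
    (Lindeberg); the sum of the replaced variables is again normal because the
    normal law is stable under convolution. Applied to smooth steps, this gives
    convergence of the distribution functions, hence pointwise convergence of
    the quantile functions, since the normal distribution function is strictly
    increasing. The quantile functions on [0, 1] couple S_n with Z, so it only
    remains to integrate the convergence, which is possible once the |S_n|^r
    are uniformly integrable. For that, X_1 is split into a centered bounded
    part and a centered remainder with small r-th moment: the moment of order p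
    of a normalized sum is at most a constant times that of a summand, applied
    with p = 2 r to the bounded part and with p = r to the remainder. *)

Require Import Defs.
From HB Require Import structures.
From mathcomp Require Import all_boot all_order all_algebra.
From mathcomp Require Import finmap.
From mathcomp Require Import all_classical all_reals all_analysis.
From mathcomp Require Import measurable_realfun.
From mathcomp Require Import ring lra.

Set Implicit Arguments.
Unset Strict Implicit.
Unset Printing Implicit Defensive.

Import Order.TTheory GRing.Theory Num.Theory.
Import numFieldNormedType.Exports.

Local Open Scope classical_set_scope.
Local Open Scope ring_scope.

(** * Integrability and independence *)

(** Only the moment of order [r] is available, and [r] may be 2. This shapes both halves of the
    proof. In the replacement argument the Taylor remainder is measured by the minimum of [|h|^3]
    and [h^2], because [n] times its mean at [X / sqrt n] tends to 0 under a second moment alone. In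
    the passage to the limit a bound on the moments of order [r] of the sums does not give uniform
    integrability; truncation does. The moment of order [2 r] of the bounded part makes the excess
    of its [r]-th power over a level [K] of order [1 / K], and the remainder is small uniformly in
    [n] because the constant of the moment inequality depends on the exponent only. The replacing
    normal variables are never realized next to the [X i]: replacing one variable means applying the
    operator [average] to the test function, and the [n]-fold iterate of this operator is computed
    by convolution. Independence is thus used only between [psum X k] and [X k]. *)

Section integrability.
Context d (T : measurableType d) (R : realType) (P : probability T R).
Implicit Types f g : T -> R.

Lemma integrable_dominated f g : measurable_fun setT f ->
  (forall x, `|f x| <= g x) -> P.-integrable setT (EFin \o g) ->
  P.-integrable setT (EFin \o f).
Proof.
move=> mf fg; apply: le_integrable => //; first exact/measurable_EFinP.
by move=> x _; rewrite !abse_EFin lee_fin (le_trans (fg x))// ler_norm.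
Qed.

Lemma integrable_ubound f (K : R) : measurable_fun setT f ->
  (forall x, `|f x| <= K) -> P.-integrable setT (EFin \o f).
Proof.
move=> mf fK; apply: (integrable_dominated (g := cst K)) => //.
exact: finite_measure_integrable_cst.
Qed.

Lemma integrableDR f g : P.-integrable setT (EFin \o f) ->
  P.-integrable setT (EFin \o g) ->
  P.-integrable setT (EFin \o (fun x => f x + g x)).
Proof. by move=> fi gi; apply: (integrableD measurableT fi gi). Qed.

Lemma integrableZR f (c : R) : P.-integrable setT (EFin \o f) ->
  P.-integrable setT (EFin \o (fun x => c * f x)).
Proof. by move=> fi; apply: (integrableZl measurableT c fi). Qed.

Lemma integrable_cstR (c : R) : P.-integrable setT (EFin \o (fun=> c)).
Proof. exact: finite_measure_integrable_cst. Qed.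

Lemma EFin_Rintegral f : P.-integrable setT (EFin \o f) ->
  (\int[P]_x f x)%:E = (\int[P]_x (f x)%:E)%E.
Proof. by move=> fi; rewrite fineK// integrable_fin_num. Qed.

Lemma Rintegral_cstT (c : R) : \int[P]_x c = c.
Proof. by rewrite Rintegral_cst//= probability_setT mulr1. Qed.

Lemma ge0_integrableP f : measurable_fun setT f -> (forall x, 0 <= f x) ->
  (P.-integrable setT (EFin \o f) <-> (\int[P]_x (f x)%:E < +oo)%E).
Proof.
move=> mf f0; have E : (\int[P]_x `|(f x)%:E| = \int[P]_x (f x)%:E)%E.
  by apply: eq_integral => x _; rewrite abse_EFin ger0_norm.
split=> [/integrableP[_]|foo]; first by rewrite /= E.
by apply/integrableP; split; [exact/measurable_EFinP|rewrite /= E].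
Qed.

Lemma Rintegral_dominated_cvg (f_ : nat -> T -> R) f g :
  (forall n, measurable_fun setT (f_ n)) -> measurable_fun setT f ->
  {ae P, forall x, f_ ^~ x @ \oo --> f x} ->
  P.-integrable setT (EFin \o g) -> (forall n x, `|f_ n x| <= g x) ->
  \int[P]_x f_ n x @[n --> \oo] --> \int[P]_x f x.
Proof.
move=> mf_ mf f_f gi f_g.
have [] := @dominated_convergence _ _ _ P setT measurableT
  (fun n => EFin \o f_ n) (EFin \o f) (EFin \o g).
- by move=> n; exact/measurable_EFinP.
- exact/measurable_EFinP.
- by apply: filterS f_f => x fx _; apply/cvg_EFin; [exact: nearW|exact: fx].
- exact: gi.
- by apply: aeW => x n _; rewrite /= lee_fin.
move=> fi _ fcvg; have := fcvg.
rewrite -(EFin_Rintegral fi) => /fine_cvg/=.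
by apply: cvg_trans; apply: near_eq_cvg; exact: nearW.
Qed.

End integrability.

Definition mfun_of d (T : measurableType d) d' (T' : measurableType d')
  (f : T -> T') (mf : measurable_fun setT f) : {mfun T >-> T'} :=
  HB.pack f (isMeasurableFun.Build _ _ _ _ f mf).

Section independence.
Context d (T : measurableType d) (R : realType) (P : probability T R).

Definition indep2 (U V : T -> R) := forall A B : set R,
  measurable A -> measurable B ->
  P (U @^-1` A `&` V @^-1` B) = (P (U @^-1` A) * P (V @^-1` B))%E.

Lemma indep2_joint (U V : {RV P >-> R}) : indep2 U V ->
  forall C : set (R * R), measurable C ->
  (distribution P U \x distribution P V)%E C = P ((fun w => (U w, V w)) @^-1` C).
Proof.
move=> UV C mC.
have mUV : measurable_fun setT (fun w => (U w, V w)).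
  by apply: measurable_fun_pair.
exact: (@product_measure_unique _ _ _ _ _ _ _ (distribution P (mfun_of mUV))).
Qed.

Lemma ge0_expectation_indep2 (U V : {RV P >-> R}) (f : R * R -> \bar R) :
  indep2 U V -> measurable_fun setT f -> (forall z, 0 <= f z)%E ->
  (\int[P]_w f (U w, V w) =
   \int[distribution P U]_x \int[distribution P V]_y f (x, y))%E.
Proof.
move=> UV mf f0.
have mUV : measurable_fun setT (fun w => (U w, V w)).
  by apply: measurable_fun_pair.
transitivity (\int[distribution P (mfun_of mUV)]_z f z)%E.
  by rewrite ge0_integral_distribution.
transitivity (\int[distribution P U \x distribution P V]_z f z)%E; last by rewrite fubini_tonelli1.
by apply: eq_measure_integral => A mA _; rewrite [RHS]indep2_joint.
Qed.

(** Tonelli applied to the absolute values gives the integrability that Fubini requires to factor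
    the signed integral. *)
Lemma integrable_mul_indep2 (U V : {RV P >-> R}) (g h : R -> R) :
  indep2 U V -> measurable_fun setT g -> measurable_fun setT h ->
  P.-integrable setT (EFin \o (g \o U)) ->
  P.-integrable setT (EFin \o (h \o V)) ->
  P.-integrable setT (EFin \o (fun w => g (U w) * h (V w))) /\
  \int[P]_w (g (U w) * h (V w)) = \int[P]_w g (U w) * \int[P]_w h (V w).
Proof.
move=> UV mg mh gi hi.
have mUV : measurable_fun setT (fun w => (U w, V w)).
  by apply: measurable_fun_pair.
have mgh : measurable_fun setT (fun z : R * R => g z.1 * h z.2).
  by apply: measurable_funM; [exact: measurableT_comp|exact: measurableT_comp].
have mgU : measurable_fun setT (g \o U) by exact: measurableT_comp.
have mhV : measurable_fun setT (h \o V) by exact: measurableT_comp.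
have gi' : (distribution P U).-integrable setT (EFin \o g).
  apply: integrable_pushforward => //. exact/measurable_EFinP.
have hi' : (distribution P V).-integrable setT (EFin \o h).
  apply: integrable_pushforward => //. exact/measurable_EFinP.
have ghi : P.-integrable setT (EFin \o (fun w => g (U w) * h (V w))).
  apply/integrableP; split; first exact/measurable_EFinP/measurable_funM.
  have mag : measurable_fun setT (fun x => `|g x|%:E).
    by apply/measurable_EFinP; exact: measurableT_comp.
  have mah : measurable_fun setT (fun x => `|h x|%:E).
    by apply/measurable_EFinP; exact: measurableT_comp.
  rewrite (@ge0_expectation_indep2 _ _ (fun z => (`|g z.1 * h z.2|)%:E))//=; last first.
    by apply/measurable_EFinP; exact: measurableT_comp.
  under eq_integral => x _.
    under eq_integral do rewrite normrM EFinM.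
    rewrite ge0_integralZl//.
    over.
  rewrite /= ge0_integralZr//.
  + rewrite lte_mul_pinfty//.
    * exact: integral_ge0.
    * by rewrite ge0_fin_numE; [by move/integrableP: gi' => []|exact: integral_ge0].
    * by move/integrableP: hi' => [].
  + exact: integral_ge0.
split => //.
pose F (z : R * R) := (g z.1 * h z.2)%:E.
have mF : measurable_fun setT F by exact/measurable_EFinP.
have jointE A : measurable A ->
    distribution P (mfun_of mUV) A = (distribution P U \x distribution P V)%E A.
  by move=> mA; exact/esym/indep2_joint.
have Fi : (distribution P U \x distribution P V)%E.-integrable setT F.
  have : (distribution P (mfun_of mUV)).-integrable setT F.
    exact: integrable_pushforward.
  move=> /integrableP[_ Foo]; apply/integrableP; split => //.
  apply: le_lt_trans Foo; rewrite le_eqVlt; apply/orP; left; apply/eqP.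
  by apply: eq_measure_integral => A mA _; first [exact: jointE|exact/esym/jointE].
transitivity (fine (\int[distribution P (mfun_of mUV)]_z F z)).
  by rewrite /Rintegral integral_distribution.
transitivity (fine (\int[distribution P U \x distribution P V]_z F z)%E).
  congr fine.
  by apply: eq_measure_integral => A mA _; first [exact: jointE|exact/esym/jointE].
rewrite -integral12_prod_meas1//= /fubini_F.
transitivity (fine (\int[distribution P U]_x ((g x)%:E * \int[distribution P V]_y (h y)%:E))%E).
  congr fine; apply: eq_integral => x _.
  by rewrite -integralZl.
rewrite -(EFin_Rintegral hi').
rewrite integralZr// -(EFin_Rintegral gi') -EFinM /=.
by rewrite /Rintegral !integral_distribution//; exact/measurable_EFinP.
Qed.

End independence.

(** * Independence of a partial sum and the next variable *)

Section partial_sums.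
Context d (T : measurableType d) (R : realType) (P : probability T R).
Variable X : nat -> {RV P >-> R}.

Definition psum (k : nat) : {RV P >-> R} := \sum_(i < k) (X i : {mfun T >-> R}).

Lemma psumE k w : psum k w = \sum_(i < k) X i w.
Proof. exact: mfun_sum. Qed.

Lemma psum0 w : psum 0 w = 0.
Proof. by rewrite psumE big_ord0. Qed.

Lemma psumS k w : psum k.+1 w = psum k w + X k w.
Proof. by rewrite !psumE big_ord_recr. Qed.

Let measurable_cap (J : {fset nat}) (A : nat -> set R) :
  (forall i, i \in J -> measurable (A i)) ->
  measurable (\bigcap_(i in [set` J]) (X i @^-1` A i)).
Proof.
move=> mA; apply: fin_bigcap_measurable => // i Ji.
rewrite -[_ @^-1` _]setTI; exact: measurable_funPT (mA _ Ji).
Qed.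

(* Two finite measures on the plane, the law of [(psum k, X k)] restricted to
   the event on the later variables and the unrestricted law scaled by the
   probability of that event, agree on rectangles; evaluating them on
   [x + y \in B] gives the induction step. *)
Lemma psum_indep_cap : mutually_independent X ->
  forall k (J : {fset nat}) (A : nat -> set R) (B : set R), measurable B ->
  (forall i, i \in J -> (k <= i)%N) ->
  (forall i, i \in J -> measurable (A i)) ->
  P (psum k @^-1` B `&` \bigcap_(i in [set` J]) (X i @^-1` A i)) =
  (P (psum k @^-1` B) * \prod_(i <- J) P (X i @^-1` A i))%E.
Proof.
move=> iX; elim => [|k IHk] J A B mB kJ mA.
  have -> : psum 0 @^-1` B = if 0 \in B then setT else set0.
    apply/seteqP; split => w /=; rewrite psum0; case: ifPn => //.
      by rewrite notin_setE.
    by rewrite inE.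
  rewrite -iX//; case: ifP => _; first by rewrite setTI probability_setT mul1e.
  by rewrite set0I measure0 mul0e.
have kNJ : k \notin J by apply/negP => /kJ; rewrite ltnn.
pose E := \bigcap_(i in [set` J]) (X i @^-1` A i).
have mE : measurable E by exact: measurable_cap.
have rect (B1 B2 : set R) : measurable B1 -> measurable B2 ->
    P (psum k @^-1` B1 `&` X k @^-1` B2 `&` E) =
    (P (psum k @^-1` B1) * P (X k @^-1` B2) * P E)%E.
  move=> mB1 mB2.
  (* The event on [X k] joins the later ones, so that the induction hypothesis applies with [J]
     enlarged by [k]. *)
  pose A' i := if i == k then B2 else A i.
  have A'J i : i \in J -> A' i = A i.
    by rewrite /A'; case: eqP => // ->; rewrite (negbTE kNJ).
  have capE : \bigcap_(i in [set` (k |` J)%fset]) (X i @^-1` A' i) =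
      X k @^-1` B2 `&` E.
    apply/seteqP; split => [w AXw|w [XkB2 Ew] i] /=.
      split; first by have := AXw k; rewrite /A' /= eqxx; apply; rewrite !inE eqxx.
      move=> i /= Ji; rewrite -A'J//.
      by apply: AXw; rewrite /= !inE Ji orbT.
    rewrite !inE => /predU1P[->|Ji]; first by rewrite /A' eqxx.
    by rewrite /= A'J//; apply: Ew.
  have := IHk (k |` J)%fset A' B1 mB1.
  rewrite capE setIA => ->.
  - rewrite big_fsetU1//= {1}/A' eqxx muleA; congr (_ * _)%E.
    rewrite iX//; rewrite !big_seq; apply: eq_bigr => i Ji.
    by rewrite A'J.
  - by move=> i; rewrite !inE => /predU1P[->//|/kJ /ltnW].
  - move=> i; rewrite !inE => /predU1P[->//|Ji]; first by rewrite /A' eqxx.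
    by rewrite A'J//; exact: mA.
have PEfin : P E \is a fin_num by rewrite fin_num_measure.
have PE0 : 0 <= fine (P E) by rewrite fine_ge0.
pose m1 := mscale (NngNum PE0) (distribution P (psum k)).
have mUV : measurable_fun setT (fun w => (psum k w, X k w)).
  by apply: measurable_fun_pair.
have prodE (C : set (R * R)) : measurable C ->
    P ((fun w => (psum k w, X k w)) @^-1` C `&` E) =
    (P E * P ((fun w => (psum k w, X k w)) @^-1` C))%E.
  move=> mC.
  transitivity ((m1 \x distribution P (X k))%E C).
    apply/esym; apply: (@product_measure_unique _ _ _ _ _ m1
      (distribution P (X k)) (pushforward (mrestr P mE) (mfun_of mUV)))  => //.
    move=> B1 B2 mB1 mB2; rewrite /m1 /= /mscale /= fineK//.
    by rewrite [LHS]rect// [LHS]muleC muleA.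
  pose m2 := mscale (NngNum PE0) (distribution P (mfun_of mUV)).
  transitivity (m2 C); last by rewrite /m2 /= /mscale /= fineK.
  apply: (@product_measure_unique _ _ _ _ _ m1 (distribution P (X k)) m2) => //.
  move=> B1 B2 mB1 mB2; rewrite /m1 /m2 /= /mscale /= fineK//.
  rewrite -muleA; congr (_ * _)%E.
  have := IHk [fset k]%fset (fun=> B2) B1 mB1.
  rewrite big_seq_fset1 /=.
  have -> : \bigcap_(i in [set` [fset k]%fset]) (X i @^-1` B2) = X k @^-1` B2.
    apply/seteqP; split => [w /(_ k)|w Xk i] /=.
      by apply; rewrite inE.
    by rewrite inE => /eqP ->.
  apply => // i; rewrite !inE => /eqP ->//.
have := prodE ((fun z => z.1 + z.2) @^-1` B).
have -> : (fun w => (psum k w, X k w)) @^-1` ((fun z => z.1 + z.2) @^-1` B) =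
    psum k.+1 @^-1` B by apply/seteqP; split => w; rewrite /= psumS.
rewrite /E iX// muleC; apply.
by rewrite -[_ @^-1` B]setTI; apply: measurable_funD.
Qed.

Lemma indep2_psum : mutually_independent X -> forall k, indep2 P (psum k) (X k).
Proof.
move=> iX k A B mA mB.
have := @psum_indep_cap iX k [fset k]%fset (fun=> B) A mA.
rewrite big_seq_fset1 /=.
have -> : \bigcap_(i in [set` [fset k]%fset]) (X i @^-1` B) = X k @^-1` B.
  apply/seteqP; split => [w /(_ k)|w Xk i] /=; first by apply; rewrite inE.
  by rewrite inE => /eqP ->.
by apply => // i; rewrite !inE => /eqP ->.
Qed.

End partial_sums.

(** * Moments of sums *)

Section same_distribution_transfer.
Context d (T : measurableType d) d' (T' : measurableType d') (R : realType)
  (P : probability T R) (Q : probability T' R).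
Variables (U : {RV P >-> R}) (V : {RV Q >-> R}).
Hypothesis UV : same_distribution U V.

Lemma same_distribution_ge0_integral (h : R -> \bar R) :
  measurable_fun setT h -> (forall x, 0 <= h x)%E ->
  (\int[P]_w h (U w) = \int[Q]_w h (V w))%E.
Proof.
move=> mh h0.
rewrite -(ge0_integral_distribution U mh h0) -(ge0_integral_distribution V mh h0).
by apply: eq_measure_integral => A mA _; exact: UV.
Qed.

Lemma same_distribution_integrable (h : R -> R) : measurable_fun setT h ->
  P.-integrable setT (EFin \o (h \o U)) ->
  Q.-integrable setT (EFin \o (h \o V)).
Proof.
move=> mh /integrableP[_ hUoo]; apply/integrableP; split.
  by apply/measurable_EFinP; exact: measurableT_comp.
rewrite -(@same_distribution_ge0_integral (fun x => `|(h x)%:E|)%E)//.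
by apply: measurableT_comp => //; exact/measurable_EFinP.
Qed.

Lemma same_distribution_Rintegral (h : R -> R) : measurable_fun setT h ->
  P.-integrable setT (EFin \o (h \o U)) ->
  \int[P]_w h (U w) = \int[Q]_w h (V w).
Proof.
move=> mh hU; have hV := same_distribution_integrable mh hU.
congr fine.
rewrite -(integral_distribution (X := U) (f := EFin \o h))//; last exact/measurable_EFinP.
rewrite -(integral_distribution (X := V) (f := EFin \o h))//; last exact/measurable_EFinP.
by apply: eq_measure_integral => A mA _; exact: UV.
Qed.

End same_distribution_transfer.

Section power_inequalities.
Context (R : realType).
Implicit Types x y t p l : R.

(** The larger of the two terms gives [|x + y| <= 2 * |x|]. *)
Lemma powR_normD x y p : 0 <= p ->
  `|x + y| `^ p <= 2 `^ p * (`|x| `^ p + `|y| `^ p).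
Proof.
move=> p0; wlog xy : x y / `|y| <= `|x|.
  move=> H; have [|/ltW] := leP `|y| `|x|; first exact: H.
  by rewrite [x + y]addrC [X in _ <= _ * X]addrC; exact: H.
apply: (@le_trans _ _ ((2 * `|x|) `^ p)).
  apply: ge0_ler_powR; rewrite ?nnegrE ?mulr_ge0//.
  by rewrite (le_trans (ler_normD _ _))// mulr2n mulrDl mul1r lerD2l.
by rewrite powRM// ler_wpM2l ?powR_ge0// lerDl powR_ge0.
Qed.

Lemma powR_invl x p : 0 <= x -> x^-1 `^ p = (x `^ p)^-1.
Proof. by move=> x0; rewrite -[in LHS]powR_inv1// -powRrM mulN1r powRN. Qed.

Lemma norm_le1DpowR x p : 1 <= p -> `|x| <= 1 + `|x| `^ p.
Proof.
move=> p1; have [x1|/ltW x1] := leP `|x| 1; first by rewrite (le_trans x1)// lerDl powR_ge0.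
by rewrite (le_trans (le1r_powR x1 p1))// lerDr.
Qed.

Lemma powR_le1DpowR x p q : 0 <= q -> q <= p -> `|x| `^ q <= 1 + `|x| `^ p.
Proof.
move=> q0 qp; have [x1|/ltW x1] := leP `|x| 1; last first.
  by rewrite (le_trans (ler_powR x1 qp))// lerDr.
rewrite (@le_trans _ _ 1)// ?lerDl ?powR_ge0//.
have <- : (1 : R) `^ q = 1 by rewrite powR1.
by rewrite ge0_ler_powR ?nnegrE.
Qed.

(** From [expR (- x) >= 1 - x] one gets [expR x <= 1 / (1 - x)], and the right-hand side times
    [1 - x] is [1 + x ^+ 2 * (1 - 2 * x)], which is at least 1. *)
Lemma expR_le_quad x : x <= 2^-1 -> expR x <= 1 + x + 2 * x ^+ 2.
Proof.
move=> x2; have e := expR_ge1Dx (- x).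
have x1 : 0 < 1 - x by lra.
have : expR x * (1 - x) <= 1.
  by rewrite -[leRHS](expRxMexpNx_1 x) ler_wpM2l ?expR_ge0.
move=> h; rewrite -(ler_pM2r x1) (le_trans h)//; nra.
Qed.

(** If [2 p |t| <= 1], then [1 + t <= expR t] and [expR_le_quad] at [p * t] give the bound with
    coefficient [2 p^2]. Otherwise [|1 + t| <= (2 p + 1) |t|], and [2 p^2 t^2] compensates a
    negative linear term. The constant is the sum of the two coefficients. *)
Lemma powR_norm1D p : 2 <= p -> exists2 C : R, 1 <= C &
  forall t, `|1 + t| `^ p <= 1 + p * t + C * (t ^+ 2 + `|t| `^ p).
Proof.
move=> p2; have p0 : 0 < p by lra.
exists (2 * p ^+ 2 + (2 * p + 1) `^ p) => [|t].
  have : 0 <= (2 * p + 1) `^ p by exact: powR_ge0.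
  by nra.
have K0 : 0 <= (2 * p + 1) `^ p by exact: powR_ge0.
have T0 : 0 <= `|t| `^ p by exact: powR_ge0.
have [tp|tp] := leP (`|t| * (2 * p)) 1.
  have /andP[t1 t2] : - 1 <= t * (2 * p) <= 1.
    by rewrite -ler_norml normrM [X in _ * X]gtr0_norm//; lra.
  have t4 : 0 <= 1 + t by nra.
  apply: (@le_trans _ _ (expR (t * p))).
    rewrite expRM ger0_norm// ge0_ler_powR ?nnegrE ?expR_ge0//; first by lra.
    exact: expR_ge1Dx.
  apply: (le_trans (expR_le_quad _)); first by lra.
  have : 0 <= (2 * p + 1) `^ p * (t ^+ 2 + `|t| `^ p).
    by rewrite mulr_ge0// addr_ge0// sqr_ge0.
  have : 0 <= 2 * p ^+ 2 * `|t| `^ p by rewrite mulr_ge0// mulr_ge0// sqr_ge0.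
  lra.
have : `|1 + t| `^ p <= (2 * p + 1) `^ p * `|t| `^ p.
  rewrite -powRM//; last by lra.
  apply: ge0_ler_powR; rewrite ?nnegrE//; [lra|rewrite mulr_ge0//; lra|].
  by rewrite (le_trans (ler_normD _ _))// normr1; nra.
have : - (p * t) <= 2 * p ^+ 2 * t ^+ 2.
  apply: (@le_trans _ _ (p * `|t|)).
    by rewrite -mulrN ler_wpM2l ?(ltW p0)// -normrN ler_norm.
  rewrite -(real_normK (num_real t)).
  have : 0 <= `|t| by []. nra.
have : 0 <= (2 * p + 1) `^ p * t ^+ 2 by rewrite mulr_ge0// sqr_ge0.
have : 0 <= 2 * p ^+ 2 * `|t| `^ p by rewrite mulr_ge0// mulr_ge0// sqr_ge0.
lra.
Qed.

Lemma powR_splitD2 x p : 2 <= p -> `|x| `^ p = `|x| `^ (p - 2) * x ^+ 2.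
Proof.
move=> p2; have [->|x0] := eqVneq x 0.
  by rewrite normr0 expr0n mulr0 powR0// gt_eqF//; lra.
rewrite -(real_normK (num_real x)) -powR_mulrn//.
by rewrite -powRD ?subrK// normr_eq0 x0 implybT.
Qed.

(* Young's inequality in the elementary form obtained by comparing [x ^+ 2]
   with [l * y ^+ 2]. *)
Lemma powR_young x y p l : 2 <= p -> 0 < l ->
  `|x| `^ (p - 2) * y ^+ 2 <= `|x| `^ p / l + l `^ (p / 2 - 1) * `|y| `^ p.
Proof.
move=> p2 l0; have [lyx|xly] := leP (l * y ^+ 2) (x ^+ 2).
  rewrite (powR_splitD2 x p2) -[leLHS]addr0 lerD ?mulr_ge0 ?powR_ge0//.
  by rewrite -mulrA ler_wpM2l ?powR_ge0// ler_pdivlMr// mulrC.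
rewrite -[leLHS]add0r lerD ?divr_ge0 ?powR_ge0 ?(ltW l0)//.
rewrite (powR_splitD2 y p2) mulrA ler_wpM2r ?sqr_ge0//.
have E z : `|z| `^ (p - 2) = (z ^+ 2) `^ (p / 2 - 1).
  rewrite -(real_normK (num_real z)) -powR_mulrn// -powRrM; congr powR; lra.
rewrite !E -powRM ?sqr_ge0 ?(ltW l0)// ge0_ler_powR ?nnegrE ?sqr_ge0//; last first.
- exact: ltW.
- by rewrite mulr_ge0 ?sqr_ge0// ltW.
- by lra.
Qed.

(** This is [powR_norm1D] at [t = y / x], multiplied by [|x|]^
    p[;]powR_young[then splits the mixed term]|x| [^ (p - 2) * y ^+ 2]. The linear term is kept
    exactly because its mean vanishes for centered [y] independent of [x], and [l] stays free so
    that it can be tuned to the number of summands. *)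
Lemma powR_normD_expand p : 2 <= p -> exists2 C : R, 1 <= C &
  forall l x y, 1 <= l -> `|x + y| `^ p <= `|x| `^ p * (1 + C / l) +
    p * (x * `|x| `^ (p - 2) * y) + 2 * C * l `^ (p / 2 - 1) * `|y| `^ p.
Proof.
move=> p2; have [C C1 HC] := powR_norm1D p2; exists C => // l x y l1.
have l0 : 0 < l by lra.
have C0 : 0 <= C by lra.
have Y := powR_young x y p2 l0.
have L1 : 1 <= l `^ (p / 2 - 1).
  by rewrite -[leLHS](powRr0 l) ler_powR//; lra.
have yp0 : 0 <= `|y| `^ p by exact: powR_ge0.
have base : `|x + y| `^ p <= `|x| `^ p + p * (x * `|x| `^ (p - 2) * y) +
    C * (`|x| `^ (p - 2) * y ^+ 2 + `|y| `^ p).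
  have [->|x0] := eqVneq x 0.
    rewrite add0r normr0 mul0r mul0r mulr0 addr0 powR0; last by rewrite gt_eqF//; lra.
    rewrite add0r (@le_trans _ _ (C * `|y| `^ p))//; first by rewrite ler_peMl.
    by rewrite ler_wpM2l// lerDr mulr_ge0 ?powR_ge0 ?sqr_ge0.
  have -> : x + y = x * (1 + y / x) by field.
  rewrite normrM powRM//.
  apply: (le_trans (ler_wpM2l (powR_ge0 _ _) (HC (y / x)))).
  rewrite normrM powRM// normfV.
  have xp0 : 0 < `|x| `^ p by rewrite powR_gt0// normr_gt0.
  have -> : `|x|^-1 `^ p = (`|x| `^ p)^-1.
    exact: powR_invl.
  rewrite le_eqVlt; apply/orP; left; apply/eqP.
  rewrite mulrDr mulrDr mulr1; congr (_ + _ + _).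
    by rewrite (powR_splitD2 x p2); field.
  rewrite [LHS]mulrCA; congr (C * _); rewrite mulrDr; congr (_ + _).
    by rewrite (powR_splitD2 x p2); field.
  by rewrite mulrCA divff ?gt_eqF// mulr1.
apply: (le_trans base).
have : C * (`|x| `^ (p - 2) * y ^+ 2) <=
   C * (`|x| `^ p / l + l `^ (p / 2 - 1) * `|y| `^ p) by rewrite ler_wpM2l.
have : C * `|y| `^ p <= C * (l `^ (p / 2 - 1) * `|y| `^ p).
  by rewrite ler_wpM2l// ler_peMl.
rewrite !mulrDr mulr1.
have -> : `|x| `^ p * (C / l) = C * (`|x| `^ p / l) by rewrite mulrCA.
lra.
Qed.

Lemma cvg_norm_powR0 (u : R^nat) p : 0 < p -> u n @[n --> \oo] --> (0 : R) ->
  `|u n| `^ p @[n --> \oo] --> (0 : R).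
Proof.
move=> p0 /cvgrPdist_le u0; apply/cvgrPdist_le => e e0.
have : 0 < e `^ p^-1 by exact: powR_gt0.
move=> /u0; apply: filterS => n; rewrite !sub0r !normrN => un.
rewrite ger0_norm ?powR_ge0// (@le_trans _ _ ((e `^ p^-1) `^ p))//.
  by rewrite ge0_ler_powR ?nnegrE ?powR_ge0// ltW.
by rewrite -powRrM mulVf ?gt_eqF// powRr1// ltW.
Qed.

End power_inequalities.

Section moment_growth.
Context d (T : measurableType d) (R : realType) (P : probability T R).

Lemma measurable_norm_powR d' (T' : measurableType d') (f : T' -> R) (p : R) :
  measurable_fun setT f -> measurable_fun setT (fun x => `|f x| `^ p).
Proof.
move=> mf; apply: (measurableT_comp (measurable_powR _)).
exact: measurableT_comp.
Qed.

Lemma integrable_powRD (f g : T -> R) (p : R) : 0 <= p ->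
  measurable_fun setT f -> measurable_fun setT g ->
  P.-integrable setT (EFin \o (fun w => `|f w| `^ p)) ->
  P.-integrable setT (EFin \o (fun w => `|g w| `^ p)) ->
  P.-integrable setT (EFin \o (fun w => `|f w + g w| `^ p)).
Proof.
move=> p0 mf mg fi gi.
apply: (@integrable_dominated _ _ _ _ _
  (fun w => 2 `^ p * (`|f w| `^ p + `|g w| `^ p))).
- by apply: measurable_norm_powR; exact: measurable_funD.
- by move=> w; rewrite ger0_norm ?powR_ge0// powR_normD.
- exact/integrableZR/integrableDR.
Qed.

Lemma integrable_powR_le (f : T -> R) (p q : R) : 0 <= q -> q <= p ->
  measurable_fun setT f ->
  P.-integrable setT (EFin \o (fun w => `|f w| `^ p)) ->
  P.-integrable setT (EFin \o (fun w => `|f w| `^ q)).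
Proof.
move=> q0 qp mf fi.
apply: (@integrable_dominated _ _ _ _ _ (fun w => 1 + `|f w| `^ p)).
- exact: measurable_norm_powR.
- by move=> w; rewrite ger0_norm ?powR_ge0// powR_le1DpowR.
- by apply: integrableDR => //; exact: integrable_cstR.
Qed.

Lemma integrable_powR1 (f : T -> R) (p : R) : 1 <= p ->
  measurable_fun setT f ->
  P.-integrable setT (EFin \o (fun w => `|f w| `^ p)) ->
  P.-integrable setT (EFin \o f).
Proof.
move=> p1 mf fi; apply: (@integrable_dominated _ _ _ _ _ (fun w => 1 + `|f w| `^ p)) => //.
- by move=> w; exact: norm_le1DpowR.
- by apply: integrableDR => //; exact: integrable_cstR.
Qed.

Variable X : nat -> {RV P >-> R}.
Hypothesis Xiid : iid X.

Lemma integrable_psum_powR (p : R) (k : nat) : 0 < p ->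
  P.-integrable setT (EFin \o (fun w => `|X 0%N w| `^ p)) ->
  P.-integrable setT (EFin \o (fun w => `|psum X k w| `^ p)).
Proof.
move=> p0 Xi; elim: k => [|k IHk].
  rewrite (_ : _ \o _ = EFin \o cst 0); first exact: integrable_cstR.
  by apply/funext => w /=; rewrite psum0 normr0 powR0// gt_eqF.
rewrite (_ : _ \o _ = EFin \o (fun w => `|psum X k w + X k w| `^ p)); last first.
  by apply/funext => w /=; rewrite psumS.
apply: integrable_powRD => //; first exact: ltW.
have [_ /(_ k) Xk] := Xiid.
have X0k : same_distribution (X 0%N) (X k) by move=> A mA; rewrite Xk.
apply: (same_distribution_integrable X0k (h := fun x => `|x| `^ p)) => //.
exact: measurable_norm_powR.
Qed.

(** The linear term of the expansion is a function of [psum X k] times the centered variable [X k],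
    so independence removes it from the mean. *)
Lemma psum_powR_step (p C l : R) (k : nat) : 2 <= p -> 1 <= l ->
  (forall x y : R, `|x + y| `^ p <= `|x| `^ p * (1 + C / l) +
    p * (x * `|x| `^ (p - 2) * y) + 2 * C * l `^ (p / 2 - 1) * `|y| `^ p) ->
  P.-integrable setT (EFin \o (fun w => `|X 0%N w| `^ p)) ->
  \int[P]_w X 0%N w = 0 ->
  \int[P]_w (`|psum X k.+1 w| `^ p) <= \int[P]_w (`|psum X k w| `^ p) * (1 + C / l)
    + 2 * C * l `^ (p / 2 - 1) * \int[P]_w (`|X 0%N w| `^ p).
Proof.
move=> p2 l1 HC Xi X0.
have mX : measurable_fun setT (fun x : R => `|x| `^ p) by exact: measurable_norm_powR.
have [iX /(_ k) Xk] := Xiid.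
have X0k : same_distribution (X 0%N) (X k) by move=> A mA; rewrite Xk.
have Xki : P.-integrable setT (EFin \o (fun w => `|X k w| `^ p)).
  exact: (same_distribution_integrable X0k (h := fun x => `|x| `^ p)).
have XiL : P.-integrable setT (EFin \o X 0%N) by apply: (integrable_powR1 _ _ Xi) => //; lra.
have XkiL : P.-integrable setT (EFin \o X k) by apply: (integrable_powR1 _ _ Xki) => //; lra.
have Si : P.-integrable setT (EFin \o (fun w => `|psum X k w| `^ p)).
  by apply: integrable_psum_powR => //; lra.
have SSi : P.-integrable setT (EFin \o (fun w => `|psum X k.+1 w| `^ p)).
  by apply: integrable_psum_powR => //; lra.
pose g (x : R) := x * `|x| `^ (p - 2).
have mg : measurable_fun setT g.
  by apply: measurable_funM => //; exact: measurable_norm_powR.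
have gi : P.-integrable setT (EFin \o (g \o psum X k)).
  apply: (@integrable_dominated _ _ _ _ _ (fun w => `|psum X k w| `^ (p - 1))).
  - exact: measurableT_comp.
  - move=> w; rewrite /g /= normrM (ger0_norm (powR_ge0 _ _)).
    have -> : p - 2 = p - 1 - 1 by lra.
    by rewrite mulr_powRB1//; lra.
  - by apply: (integrable_powR_le _ _ _ Si) => //; lra.
have [gXi gXE] := integrable_mul_indep2 (h := id) (indep2_psum iX k) mg
  (@measurable_id _ _ _) gi XkiL.
rewrite (same_distribution_Rintegral X0k (h := id)) // in X0.
rewrite /= X0 mulr0 in gXE.
have -> : \int[P]_w (`|X 0%N w| `^ p) = \int[P]_w (`|X k w| `^ p).
  exact: (same_distribution_Rintegral X0k (h := fun x => `|x| `^ p)).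
pose F w := (1 + C / l) * `|psum X k w| `^ p + p * (g (psum X k w) * X k w).
pose G w := 2 * C * l `^ (p / 2 - 1) * `|X k w| `^ p.
have Fi : P.-integrable setT (EFin \o F).
  by apply: integrableDR; exact: integrableZR.
have Gi : P.-integrable setT (EFin \o G) by exact: integrableZR.
apply: (@le_trans _ _ (\int[P]_w (F w + G w))).
  apply: le_Rintegral => //; first exact: integrableDR.
  by move=> w _; rewrite psumS /F /G [_ * `|psum X k w| `^ p]mulrC.
rewrite RintegralD// /G RintegralZl// /F RintegralD//; [|exact: integrableZR..].
by rewrite !RintegralZl// gXE mulr0 addr0 mulrC.
Qed.

End moment_growth.

(** The arithmetic of the induction in [psum_powR_le]: [K] is the number of summands, [A] and [A']
    are [K] and [K + 1] to the power [p / 2 - 1], [m] is the moment of one summand and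
    [l = 2 * C * K]. The factor [1 + C / l] turns [K] into [K + 1 / 2], and the other half absorbs
    [2 * C * (c * A) * m]; hence the coefficient [4 * C * c]. *)
Lemma growth_step (R : realType) (C c K A A' m a : R) :
  1 <= C -> 0 <= c -> 0 < K -> 0 <= A -> A <= A' -> 0 <= m ->
  a <= (4 * C * c + 1) * (K * A) * m ->
  a * (1 + C / (2 * C * K)) + 2 * C * (c * A) * m <=
    (4 * C * c + 1) * ((K + 1) * A') * m.
Proof.
move=> C1 c0 K0 A0 AA' m0 aK.
have -> : 1 + C / (2 * C * K) = 1 + (2 * K)^-1 by field; rewrite !gt_eqF//; lra.
have D0 : 0 <= 4 * C * c + 1 by rewrite addr_ge0// mulr_ge0//; lra.
apply: (@le_trans _ _ ((4 * C * c + 1) * ((K + 1) * A) * m)); last first.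
  by rewrite ler_wpM2r// ler_wpM2l// ler_wpM2l//; lra.
have h : a * (1 + (2 * K)^-1) <= (4 * C * c + 1) * (K * A) * m * (1 + (2 * K)^-1).
  by rewrite ler_wpM2r// addr_ge0// invr_ge0; lra.
have E : (4 * C * c + 1) * (K * A) * m * (1 + (2 * K)^-1) =
    (4 * C * c + 1) * A * m * (K + 2^-1) by field; rewrite gt_eqF.
rewrite E in h.
have -> : (4 * C * c + 1) * ((K + 1) * A) * m =
    (4 * C * c + 1) * A * m * (K + 2^-1) + 2 * C * (c * A) * m + A * m / 2 by field.
by rewrite -addrA lerD// lerDl divr_ge0// mulr_ge0.
Qed.

(* The growth rate of the Marcinkiewicz-Zygmund inequality, obtained by choosing
   [l] proportional to [k] in the expansion of [|S_k + X_k| `^ p]. *)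
Lemma psum_powR_le (R : realType) (p : R) : 2 <= p -> exists2 D : R, 0 <= D &
  forall d (T : measurableType d) (P : probability T R) (X : nat -> {RV P >-> R}),
  iid X -> P.-integrable setT (EFin \o (fun w => `|X 0%N w| `^ p)) ->
  \int[P]_w X 0%N w = 0 ->
  forall k, \int[P]_w (`|psum X k w| `^ p) <=
    D * (k%:R * k%:R `^ (p / 2 - 1)) * \int[P]_w (`|X 0%N w| `^ p).
Proof.
move=> p2; have [C C1 HC] := powR_normD_expand p2.
pose q := p / 2 - 1; have q0 : 0 <= q by rewrite /q; lra.
pose c := (2 * C) `^ q; have c0 : 0 <= c by exact: powR_ge0.
have C2 : 1 <= 2 * C by lra.
have Cc0 : 0 <= 4 * C * c by rewrite mulr_ge0//; lra.
have D0 : 0 <= 4 * C * c + 1 by rewrite addr_ge0.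
exists (4 * C * c + 1) => // d T P X Xiid Xi X0.
have m0 : 0 <= \int[P]_w (`|X 0%N w| `^ p).
  by apply: Rintegral_ge0 => w _; exact: powR_ge0.
(* The choice [l = 2 * C * k] satisfies [1 <= l] only for positive [k], so the induction starts at
   1, where the summand 1 in the constant makes the bound hold. *)
elim => [|[_|k IHk]].
- rewrite mul0r mulr0 mul0r le_eqVlt; apply/orP; left; apply/eqP.
  rewrite (_ : (fun w => `|psum X 0 w| `^ p) = fun=> 0) ?Rintegral_cstT//.
  by apply/funext => w; rewrite psum0 normr0 powR0// gt_eqF//; lra.
- rewrite powR1 !mulr1.
  under eq_Rintegral do rewrite psumS psum0 add0r.
  by rewrite ler_peMl// lerDr.
- have l1 : 1 <= 2 * C * k.+1%:R.
    by rewrite -[leLHS]mulr1 ler_pM// ler1n.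
  have := psum_powR_step Xiid k.+1 p2 l1 (fun x y => HC _ x y l1) Xi X0.
  rewrite -/q in IHk *.
  move/le_trans; apply.
  have K0 : (0 : R) < k.+1%:R by rewrite ltr0n.
  set K : R := k.+1%:R in IHk l1 K0 *.
  have -> : k.+2%:R = K + 1 :> R by rewrite /K -[in LHS]addn1 natrD.
  clearbody K.
  rewrite powRM ?(ltW K0) ?(le_trans ler01 C2)//.
  apply: growth_step => //; first exact: powR_ge0.
  have K00 := ltW K0.
  by apply: ge0_ler_powR; rewrite ?nnegrE ?lerDl// addr_ge0.
Qed.

(** * Uniform integrability of the normalized sums *)

Section uniform_integrability.
Context d (T : measurableType d) (R : realType) (P : probability T R).

Lemma iid_comp (X : nat -> {RV P >-> R}) (g : R -> R)
    (mgX : forall i, measurable_fun setT (g \o X i)) : measurable_fun setT g ->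
  iid X -> iid (fun i => mfun_of (mgX i) : {RV P >-> R}).
Proof.
move=> mg [iX sX]; split=> [J A mA|i A mA].
  by apply: (iX J (fun i => g @^-1` A i)) => i /mA mAi; rewrite -[_ @^-1` _]setTI; exact: mg.
by apply: (sX i (g @^-1` A)); rewrite -[_ @^-1` _]setTI; exact: mg.
Qed.

Lemma psum_normalized_powR_le (p : R) : 2 <= p -> exists2 D : R, 0 <= D &
  forall (X : nat -> {RV P >-> R}), iid X ->
  P.-integrable setT (EFin \o (fun w => `|X 0%N w| `^ p)) ->
  \int[P]_w X 0%N w = 0 -> forall n,
  P.-integrable setT (EFin \o (fun w => `|psum X n w / Num.sqrt n%:R| `^ p)) /\
  \int[P]_w (`|psum X n w / Num.sqrt n%:R| `^ p) <= D * \int[P]_w (`|X 0%N w| `^ p).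
Proof.
move=> p2; have [D D0 HD] := psum_powR_le p2; exists D => // X Xiid Xi X0 n.
have p0 : 0 < p by lra.
have m0 : 0 <= \int[P]_w (`|X 0%N w| `^ p).
  by apply: Rintegral_ge0 => w _; exact: powR_ge0.
have Si := integrable_psum_powR Xiid n p0 Xi.
have [n0|n0] := posnP n.
  rewrite n0 (_ : (fun w => _) = fun=> 0); last first.
    by apply/funext => w; rewrite psum0 mul0r normr0 powR0// gt_eqF.
  by rewrite Rintegral_cstT mulr_ge0//; split => //; exact: integrable_cstR.
have nR : (0 : R) < n%:R by rewrite ltr0n.
have E : (fun w => `|psum X n w / Num.sqrt n%:R| `^ p) =
    fun w => (n%:R * n%:R `^ (p / 2 - 1))^-1 * `|psum X n w| `^ p.
  apply/funext => w; rewrite normrM powRM// mulrC; congr (_ * _).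
  rewrite normfV powR_invl// ger0_norm ?sqrtr_ge0//.
  rewrite -powR12_sqrt ?(ltW nR)// -powRrM mulr_powRB1 ?(ltW nR)//; last by lra.
  by rewrite mulrC.
rewrite E; split; first exact: integrableZR.
rewrite RintegralZl// ler_pdivrMl ?mulr_gt0 ?powR_gt0//.
by apply: (le_trans (HD _ _ _ _ Xiid Xi X0 n)); rewrite -[leLHS]mulrA [leRHS]mulrCA.
Qed.

Definition cutoff (M x : R) : R := if `|x| <= M then x else 0.

Lemma measurable_cutoff M : measurable_fun setT (cutoff M).
Proof.
apply: measurable_fun_ifT => //.
by apply: measurable_fun_ler => //; exact: normr_measurable.
Qed.

Lemma norm_cutoff_le M x : `|cutoff M x| <= `|x|.
Proof. by rewrite /cutoff; case: ifP => // _; rewrite normr0. Qed.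

Lemma norm_cutoff_bound M x : 0 <= M -> `|cutoff M x| <= M.
Proof. by rewrite /cutoff; case: ifP => // _; rewrite normr0. Qed.

Lemma cvg_cutoff x : cutoff n%:R x @[n --> \oo] --> x.
Proof.
apply: (cvg_near_cst); near=> n; rewrite /cutoff ifT//.
by near: n; exact: nbhs_infty_ger.
Unshelve. all: by end_near. Qed.

(** Taken at a multiple of a [p]-th power, this bounds the excess over [K] by a moment of order
    [2 p] divided by [K]. *)
Lemma sub_le_sqr_div (u K : R) : 0 < K -> 0 <= u -> u - K <= u ^+ 2 / K.
Proof.
move=> K0 u0; rewrite ler_pdivlMr//.
have : 0 <= u * K by rewrite mulr_ge0// ltW.
have := sqr_ge0 (u - K); have := sqr_ge0 u; nra.
Qed.

(** The order of choices matters: the truncation level [M] makes the remainder small for all [n] at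
    once, and only then is [K] taken large against the moment of order [2 p] of the part truncated
    at [M]. *)
Lemma psum_uniform_integrable (X : nat -> {RV P >-> R}) (p : R) : 2 <= p ->
  iid X -> P.-integrable setT (EFin \o (fun w => `|X 0%N w| `^ p)) ->
  \int[P]_w X 0%N w = 0 ->
  forall e : R, 0 < e -> exists2 K : R, 0 <= K & forall n,
  \int[P]_w Num.max (`|psum X n w / Num.sqrt n%:R| `^ p - K) 0 <= e.
Proof.
move=> p2 Xiid Xi X0 e e0; have p0 : 0 < p by lra.
have e20 : 0 < e / 2 by lra.
have p4 : 2 <= p * 2 by lra.
have [D D0 HD] := psum_normalized_powR_le p2.
have [D' D'0 HD'] := psum_normalized_powR_le p4.
have XL : P.-integrable setT (EFin \o X 0%N) by apply: (integrable_powR1 _ _ Xi) => //; lra.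
have mX0 : measurable_fun setT (X 0%N) by [].
pose c M := \int[P]_w cutoff M (X 0%N w).
have mcX M i : measurable_fun setT (cutoff M \o X i).
  by apply: measurableT_comp => //; exact: measurable_cutoff.
have cXi M : P.-integrable setT (EFin \o (cutoff M \o X 0%N)).
  apply: (integrable_dominated (mcX M 0%N) _ (integrable_norm XL)) => w /=.
  exact: norm_cutoff_le.
(* Truncation destroys the zero mean that the moment inequality requires; moving the constant [c M]
   from one part to the other restores it in both. *)
pose gY M (x : R) := cutoff M x - c M.
pose gW M (x : R) := x - cutoff M x + c M.
have mgY M : measurable_fun setT (gY M).
  by apply: measurable_funB => //; exact: measurable_cutoff.
have mgW M : measurable_fun setT (gW M).
  by apply: measurable_funD => //; apply: measurable_funB => //; exact: measurable_cutoff.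
have mY M i : measurable_fun setT (gY M \o X i) by exact: measurableT_comp.
have mW M i : measurable_fun setT (gW M \o X i) by exact: measurableT_comp.
pose Y M i : {RV P >-> R} := mfun_of (mY M i).
pose W M i : {RV P >-> R} := mfun_of (mW M i).
have XYW M n w : psum X n w = psum (Y M) n w + psum (W M) n w.
  rewrite !psumE -big_split/=; apply: eq_bigr => i _.
  by rewrite /gY /gW; lra.
have EY M : \int[P]_w Y M 0%N w = 0.
  rewrite /= /gY RintegralB//; [|exact: cXi|exact: integrable_cstR].
  by rewrite Rintegral_cstT subrr.
have EW M : \int[P]_w W M 0%N w = 0.
  rewrite /= /gW RintegralD//; last exact: integrable_cstR; last first.
    exact: (integrableB measurableT XL (cXi M)).
  by rewrite RintegralB//; [rewrite Rintegral_cstT X0 sub0r addNr|exact: cXi].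
have normc M : `|c M| <= \int[P]_w `|X 0%N w|.
  apply: (le_trans (le_normr_Rintegral _ _)) => //; first exact: cXi.
  apply: le_Rintegral => //; [exact: (integrable_norm (cXi M))|exact: integrable_norm|].
  by move=> w _; exact: norm_cutoff_le.
set m1 := \int[P]_w `|X 0%N w| in normc.
have m10 : 0 <= m1 by apply: Rintegral_ge0.
(* A domination that does not depend on [M], for the dominated convergence in [Wcvg]. *)
have gWle M x : `|gW M x| `^ p <= 2 `^ p * (`|x| `^ p + m1 `^ p).
  apply: (@le_trans _ _ (`| `|x| + m1| `^ p)).
    apply: ge0_ler_powR; rewrite ?nnegrE//; first by rewrite ltW.
    rewrite [leRHS]ger0_norm ?addr_ge0// /gW (le_trans (ler_normD _ _))// lerD//.
    by rewrite /cutoff; case: ifP => _; rewrite ?subrr ?subr0 ?normr0.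
  apply: (le_trans (powR_normD _ _ (ltW p0))).
  by rewrite normr_id (ger0_norm m10).
have mpow (g : R -> R) : measurable_fun setT g ->
    measurable_fun setT (fun w => `|g (X 0%N w)| `^ p).
  by move=> mg; apply: measurable_norm_powR; exact: (measurableT_comp mg).
have domi : P.-integrable setT (EFin \o (fun w => 2 `^ p * (`|X 0%N w| `^ p + m1 `^ p))).
  by apply: integrableZR; apply: integrableDR => //; exact: integrable_cstR.
have Wi M : P.-integrable setT (EFin \o (fun w => `|W M 0%N w| `^ p)).
  apply: (integrable_dominated _ _ domi); first exact: mpow.
  by move=> w; rewrite ger0_norm ?powR_ge0//; exact: gWle.
have Wcvg : \int[P]_w (`|W n%:R 0%N w| `^ p) @[n --> \oo] --> (0 : R).
  have c0 : c n%:R @[n --> \oo] --> (0 : R).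
    rewrite -X0; apply: (Rintegral_dominated_cvg (g := fun w => `|X 0%N w|)) => //.
    - by move=> n; exact: mcX.
    - by apply: aeW => w; exact: cvg_cutoff.
    - exact: integrable_norm.
    - by move=> n w; exact: norm_cutoff_le.
  rewrite -(Rintegral_cstT P 0).
  apply: (Rintegral_dominated_cvg _ _ _ domi) => //.
  - by move=> n; exact: mpow.
  - apply: aeW => w.
    apply: cvg_norm_powR0 => //=.
    rewrite -[X in _ --> X](addr0 0) -[X in _ --> X + _](subrr (X 0%N w)).
    by apply: cvgD => //; apply: cvgB; [exact: cvg_cst|exact: cvg_cutoff].
  - by move=> n w; rewrite ger0_norm ?powR_ge0//; exact: gWle.
have [M M0 HM] : exists2 M, 0 <= M & 2 `^ p * (D * \int[P]_w (`|W M 0%N w| `^ p)) <= e / 2.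
  (* [D] may be 0; adding 1 makes the division legitimate. *)
  have pD0 : 0 < 2 `^ p * D + 1 by rewrite ltr_wpDl// mulr_ge0// powR_ge0.
  have dl0 : 0 < e / 2 / (2 `^ p * D + 1) by rewrite !divr_gt0.
  move/cvgrPdist_le : Wcvg => /(_ _ dl0)[N _ /(_ N (leqnn N))].
  have I0 : 0 <= \int[P]_w (`|W N%:R 0%N w| `^ p).
    by apply: Rintegral_ge0 => w _; exact: powR_ge0.
  rewrite /= sub0r normrN ger0_norm// ler_pdivlMr// => HN; exists N%:R => //.
  rewrite mulrA (le_trans _ HN)// mulrC ler_wpM2l// lerDl ler01//.
have Yi : P.-integrable setT (EFin \o (fun w => `|Y M 0%N w| `^ (p * 2))).
  apply: (@integrable_ubound _ _ _ _ _ ((M + m1) `^ (p * 2))).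
    by apply: measurable_norm_powR; exact: measurableT_comp.
  move=> w; rewrite ger0_norm ?powR_ge0// ge0_ler_powR ?nnegrE ?addr_ge0 ?mulr_ge0 ?(ltW p0)//.
  by rewrite /= /gY (le_trans (ler_normB _ _))// lerD// norm_cutoff_bound.
set mY2 := \int[P]_w (`|Y M 0%N w| `^ (p * 2)) in HD'.
pose C := (2 `^ p) ^+ 2 * (D' * mY2).
have C0 : 0 <= C.
  by rewrite mulr_ge0 ?sqr_ge0// mulr_ge0//; apply: Rintegral_ge0 => w _; exact: powR_ge0.
(* This gives [C / K <= e / 2], and the summand 1 keeps [K] positive. *)
exists (C / (e / 2) + 1) => [|n]; first by rewrite addr_ge0// divr_ge0// ltW.
set K := _ + 1; have K0 : 0 < K by rewrite ltr_wpDl ?divr_ge0// ltW.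
have [Wni Wn] := HD _ (iid_comp (mW M) (mgW M) Xiid) (Wi M) (EW M) n.
have [Yni Yn] := HD' _ (iid_comp (mY M) (mgY M) Xiid) Yi (EY M) n.
pose A w := `|psum (Y M) n w / Num.sqrt n%:R| `^ (p * 2).
pose B w := `|psum (W M) n w / Num.sqrt n%:R| `^ p.
have bound w : Num.max (`|psum X n w / Num.sqrt n%:R| `^ p - K) 0 <=
    2 `^ p * B w + (2 `^ p) ^+ 2 / K * A w.
  rewrite ge_max; apply/andP; split; last first.
    by rewrite addr_ge0// mulr_ge0 ?powR_ge0// divr_ge0 ?sqr_ge0 ?ltW.
  rewrite (XYW M) mulrDl /A /B powRrM powR_mulrn ?powR_ge0//.
  set a := psum _ _ _ / _; set b := psum _ _ _ / _.
  apply: (le_trans (lerB (powR_normD a b (ltW p0)) (lexx K))).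
  rewrite -[_ / K * _]mulrAC -exprMn.
  rewrite mulrDr [leLHS]addrAC addrC lerD2l.
  by rewrite sub_le_sqr_div// mulr_ge0 ?powR_ge0.
have Bndi : P.-integrable setT (EFin \o (fun w => 2 `^ p * B w + (2 `^ p) ^+ 2 / K * A w)).
  by apply: integrableDR; exact: integrableZR.
apply: (@le_trans _ _ (\int[P]_w (2 `^ p * B w + (2 `^ p) ^+ 2 / K * A w))).
  apply: le_Rintegral => //.
  apply: (integrable_dominated _ _ Bndi).
    apply: measurable_maxr => //; apply: measurable_funB => //.
    by apply: measurable_norm_powR; exact: measurable_funM.
  by move=> w; rewrite ger0_norm ?le_max ?lexx ?orbT.
rewrite RintegralD//; [|exact: integrableZR..].
rewrite !RintegralZl//.
apply: (@le_trans _ _ (e / 2 + e / 2)); last by rewrite -splitr.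
apply: lerD; first by apply: le_trans HM; rewrite ler_wpM2l ?powR_ge0.
apply: (@le_trans _ _ (C / K)).
  by rewrite /C mulrAC ler_wpM2r ?invr_ge0 ?(ltW K0)// ler_wpM2l ?sqr_ge0.
by rewrite ler_pdivrMr// /K mulrDr mulr1 mulrCA divff ?gt_eqF// mulr1 lerDl ltW.
Qed.

End uniform_integrability.

(** * The normal law *)

Ltac meas := repeat first
  [ done
  | apply: measurable_funM | apply: measurable_funB | apply: measurable_funD
  | apply: measurable_funN
  | apply: measurable_funX
  | match goal with H : measurable_fun _ ?f |- _ => apply: (measurableT_comp H) end ].

Ltac emeas := apply/measurable_EFinP; meas.

Ltac nneg := try move=> ? _; try move=> ?; rewrite ?lee_fin ?mule_ge0 ?mulr_ge0 //.

Section affine_change_of_variables.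
Context (R : realType).
Local Notation mu := (@lebesgue_measure R).
Local Open Scope ereal_scope.

(** The image of Lebesgue measure under the affine map, scaled by [a], gives half-open intervals
    their length, hence is Lebesgue measure. *)
Lemma ge0_integral_affine (f : R -> \bar R) (a b : R) : (0 < a)%R ->
  measurable_fun setT f -> (forall x, 0 <= f x) ->
  \int[mu]_x f x = a%:E * \int[mu]_x f (a * x + b)%R.
Proof.
move=> a0 mf f0.
have mg0 : measurable_fun setT (fun x : R => a * x + b)%R.
  by apply: measurable_funD => //; apply: measurable_funM.
pose g (x : measurableTypeR R) : measurableTypeR R := (a * x + b)%R.
have mg : measurable_fun setT g by exact: mg0.
have a0' : (0 <= a)%R := ltW a0.
pose gm : {mfun measurableTypeR R >-> measurableTypeR R} := mfun_of mg.
rewrite -[RHS]/(a%:E * \int[mu]_(x in gm @^-1` setT) (f \o gm) x).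
rewrite -(ge0_integral_pushforward (phi := gm) mg)//.
rewrite -[a]/(NngNum a0')%:num -(ge0_integral_mscale _ measurableT)//.
apply: eq_measure_integral => A mA _; apply: lebesgue_measure_unique => //= _ [[u v]] _ <-.
rewrite /mscale /pushforward /=.
have gE : g @^-1` `]u, v]%classic = `]((u - b) / a)%R, ((v - b) / a)%R]%classic.
  apply/seteqP; split => x /=; rewrite !in_itv/=.
    by rewrite ltr_pdivrMr// ler_pdivlMr// mulrC ltrBlDr lerBrDr.
  by rewrite ltr_pdivrMr// ler_pdivlMr// mulrC ltrBlDr lerBrDr.
rewrite /pushforward gE !lebesgue_measure_itv/= !lte_fin ltr_pM2r ?invr_gt0// ltrD2r.
case: ifP => _; last by rewrite mule0.
by rewrite -EFinB -EFinM; congr EFin; field; rewrite gt_eqF.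
Qed.

Lemma ge0_integral_oppr (f : R -> \bar R) :
  measurable_fun setT f -> (forall x, 0 <= f x) ->
  \int[mu]_x f (- x)%R = \int[mu]_x f x.
Proof.
move=> mf f0.
pose g : measurableTypeR R -> measurableTypeR R := -%R.
have mg : measurable_fun setT g by exact: (@oppr_measurable R setT).
rewrite -[LHS]/(\int[mu]_(x in g @^-1` setT) (f \o g) x).
rewrite -(ge0_integral_pushforward mg)//.
by apply: eq_measure_integral => A mA _; exact: lebesgue_measureN.
Qed.

Lemma ge0_tonelli_lebesgue (K : R -> R -> R) :
  measurable_fun setT (fun z : R * R => K z.1 z.2) -> (forall x y, 0 <= K x y)%R ->
  \int[mu]_x \int[mu]_y (K x y)%:E = \int[mu]_y \int[mu]_x (K x y)%:E.
Proof.
move=> mK K0.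
pose F (z : measurableTypeR R * measurableTypeR R) : \bar R := (K z.1 z.2)%:E.
have mF : measurable_fun setT F by apply/measurable_EFinP; exact: mK.
have F0 z : 0 <= F z by rewrite lee_fin.
exact: (fubini_tonelli _ mF F0).
Qed.

End affine_change_of_variables.

Section normal_law.
Context (R : realType) (s : R).
Hypothesis s0 : 0 < s.
Local Notation mu := (@lebesgue_measure R).
Local Notation gamma := (normal_prob 0 s).
Local Notation phi := (normal_pdf 0 s).

Let sN0 : s != 0. Proof. by rewrite gt_eqF. Qed.

(** The change of variables formula involves the Radon-Nikodym derivative, which agrees almost
    everywhere with the density because both have the same integral over every measurable set. *)
Lemma ge0_integral_normal_prob (f : R -> \bar R) :
  measurable_fun setT f -> (forall x, 0 <= f x)%E ->
  (\int[gamma]_x f x = \int[mu]_x (f x * (phi x)%:E))%E.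
Proof.
move=> mf f0.
have mphi : measurable_fun setT (EFin \o phi).
  apply/measurable_EFinP; exact: measurable_normal_pdf.
rewrite -(Radon_Nikodym_SigmaFinite.change_of_variables (normal_prob_dominates 0 s))//.
have dom := normal_prob_dominates 0 s.
have mRN : measurable_fun setT (Radon_Nikodym_SigmaFinite.f gamma mu).
  by apply: (measurable_int mu); exact: Radon_Nikodym_SigmaFinite.f_integrable.
apply: ae_eq_integral => //.
- by apply: emeasurable_funM.
- by apply: emeasurable_funM.
- apply: ae_eqe_mul2l => /=.
  apply: integral_ae_eq => //; first exact: Radon_Nikodym_SigmaFinite.f_integrable.
  by move=> E _ mE; rewrite -Radon_Nikodym_SigmaFinite.f_integral.
Qed.

Lemma normal_pdf0E x : phi x = normal_peak s * expR (- (x ^+ 2 / (s ^+ 2 *+ 2))).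
Proof. by rewrite normal_pdfE// /normal_fun subr0 mulNr. Qed.

Lemma normal_pdf_even x : phi (- x) = phi x.
Proof. by rewrite !normal_pdf0E sqrrN. Qed.

Lemma ge0_integral_normal_oppr (f : R -> \bar R) :
  measurable_fun setT f -> (forall x, 0 <= f x)%E ->
  (\int[gamma]_x f (- x)%R = \int[gamma]_x f x)%E.
Proof.
move=> mf f0; rewrite !ge0_integral_normal_prob//; last exact: measurableT_comp.
under eq_integral do rewrite -normal_pdf_even.
rewrite (ge0_integral_oppr (f := fun x => f x * (phi x)%:E)%E)//.
- apply: emeasurable_funM => //; apply/measurable_EFinP; exact: measurable_normal_pdf.
- by move=> x; rewrite mule_ge0// lee_fin normal_pdf_ge0.
Qed.

(** Stability of the centered normal law under convolution. The base point [x] is carried along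
    because [average] is iterated as an operator on functions. *)
Lemma normal_convolution (f : R -> R) (x a b r : R) :
  0 < a -> 0 < b -> 0 < r -> r ^+ 2 = a ^+ 2 + b ^+ 2 ->
  measurable_fun setT f -> (forall x, 0 <= f x) ->
  (\int[gamma]_z \int[gamma]_w (f (x + a * z + b * w))%:E =
   \int[gamma]_u (f (x + r * u))%:E)%E.
Proof.
move=> a0 b0 r0 rab mf f0.
have mphi : measurable_fun setT phi by exact: measurable_normal_pdf.
have phi0 := normal_pdf_ge0 0 s.
(* Completing the square in [z] after the substitution [u = a * z + b * w]: the first factor is free
   of [z], and the second integrates to [b / r] over [z] ([peak]). *)
have split u z : phi ((u - a * z) / b) * phi z =
    phi (u / r) * phi (r / b * z - a * u / (r * b)).
  rewrite !normal_pdf0E [LHS]mulrACA [RHS]mulrACA -!expRD.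
  congr (_ * expR _).
  have e1 : ((u - a * z) / b) ^+ 2 + z ^+ 2 =
      ((u - a * z) ^+ 2 * r ^+ 2 + z ^+ 2 * r ^+ 2 * b ^+ 2) / (b ^+ 2 * r ^+ 2).
    by field; rewrite !gt_eqF.
  have e2 : (u / r) ^+ 2 + (r / b * z - a * u / (r * b)) ^+ 2 =
      (u ^+ 2 * b ^+ 2 + (r ^+ 2 * z - a * u) ^+ 2) / (b ^+ 2 * r ^+ 2).
    by field; rewrite !gt_eqF.
  by rewrite -!opprD -!mulrDl e1 e2; congr (- (_ / _ / _)); rewrite rab; ring.
have b0' := ltW b0; have r0' := ltW r0; have bi0 : 0 <= b^-1 by rewrite invr_ge0.
have ri0 : 0 <= r^-1 by rewrite invr_ge0.
have inner z : (\int[gamma]_w (f (x + a * z + b * w))%:E =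
    \int[mu]_u (b^-1 * f (x + u) * phi ((u - a * z) / b))%:E)%E.
  rewrite ge0_integral_normal_prob; [|emeas|nneg].
  rewrite [RHS](@ge0_integral_affine _ _ b (a * z))//; [|emeas|nneg].
  rewrite -ge0_integralZl//; [|emeas|nneg].
  apply: eq_integral => w _; rewrite -!EFinM; congr EFin.
  have -> : (b * w + a * z - a * z) / b = w by field; rewrite gt_eqF.
  rewrite [b * w + _]addrC addrA.
  by rewrite !mulrA divff ?mul1r ?gt_eqF.
have peak u : (\int[mu]_z (phi (r / b * z - a * u / (r * b)))%:E = (b / r)%:E)%E.
  have rb0 : 0 < r / b by rewrite divr_gt0.
  have := @ge0_integral_affine _ (EFin \o phi) (r / b) (- (a * u / (r * b))) rb0.
  rewrite /= integral_normal_pdf => E.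
  have -> : (\int[mu]_z (phi (r / b * z - a * u / (r * b)))%:E =
    (b / r)%:E * ((r / b)%:E * \int[mu]_z (phi (r / b * z - a * u / (r * b)))%:E))%E.
    rewrite muleA -EFinM (_ : b / r * (r / b) = 1) ?mul1e//.
    by field; rewrite !gt_eqF.
  by rewrite -E ?mule1//; emeas.
rewrite ge0_integral_normal_prob; last 2 first.
- by apply: (@measurable_fun_fubini_tonelli_F _ _ _ _ _ gamma
    (fun zw => (f (x + a * zw.1 + b * zw.2))%:E)); [emeas|nneg].
- by move=> z; apply: integral_ge0; nneg.
pose K z u := b^-1 * f (x + u) * (phi (u / r) * phi (r / b * z - a * u / (r * b))).
transitivity (\int[mu]_z \int[mu]_u (K z u)%:E)%E.
  apply: eq_integral => z _; rewrite inner.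
  rewrite -ge0_integralZr//; [|emeas|nneg|nneg].
  apply: eq_integral => u _; rewrite -EFinM /K -split; congr EFin.
  by rewrite !mulrA.
have mK : measurable_fun setT (fun zu : R * R => K zu.1 zu.2).
  by rewrite /K; meas.
have K0 z u : 0 <= K z u by rewrite /K; nneg.
transitivity (\int[mu]_u \int[mu]_z (K z u)%:E)%E.
  exact: ge0_tonelli_lebesgue.
rewrite /K.
rewrite ge0_integral_normal_prob; [|emeas|nneg].
have -> : (\int[mu]_u ((f (x + r * u))%:E * (phi u)%:E) =
   (r^-1)%:E * \int[mu]_u (f (x + u) * phi (u / r))%:E)%E.
  rewrite [in RHS](@ge0_integral_affine _ _ r 0)//; [|emeas|nneg].
  rewrite muleA -EFinM mulVf ?gt_eqF// mul1e.
  apply: eq_integral => u _; rewrite addr0 -EFinM; congr (_ * phi _)%:E.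
  by field; rewrite gt_eqF.
rewrite -ge0_integralZl//; [|emeas|nneg].
apply: eq_integral => u _.
under eq_integral do rewrite mulrA EFinM.
rewrite ge0_integralZl//; [|emeas|nneg|nneg].
rewrite peak -!EFinM; congr EFin.
by field; rewrite !gt_eqF.
Qed.

(** Tonelli on the wedge [0 <= x <= t], whose section at [t] has length [t]. It plays the role of
    integration by parts in the second moment. *)
Lemma ge0_tonelli_halfline (g : R -> R) : measurable_fun setT g ->
  (forall t, 0 <= t -> 0 <= g t) ->
  (\int[mu]_(x in `[0%R, +oo[) \int[mu]_(t in `[x, +oo[) (g t)%:E =
   \int[mu]_(t in `[0%R, +oo[) (t * g t)%:E)%E.
Proof.
move=> mg g0.
pose F (x t : R) : R := if (0 <= x) && (x <= t) then g t else 0.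
have mF : measurable_fun setT (fun z : R * R => F z.1 z.2).
  apply: measurable_fun_ifT => //; last by meas.
  by apply: measurable_and; exact: measurable_fun_ler.
have F0 x t : 0 <= F x t.
  by rewrite /F; case: ifPn => // /andP[z1 z2]; rewrite g0// (le_trans z1).
transitivity (\int[mu]_x \int[mu]_t (F x t)%:E)%E.
  rewrite integral_mkcond; apply: eq_integral => x _.
  rewrite patchE mem_setE in_itv/= andbT /F/=; case: ifPn => x0.
    rewrite integral_mkcond; apply: eq_integral => t _.
    by rewrite patchE mem_setE in_itv/= andbT; case: ifPn.
  by rewrite integral0.
rewrite ge0_tonelli_lebesgue//.
rewrite [RHS]integral_mkcond; apply: eq_integral => t _.
rewrite patchE mem_setE in_itv/= andbT; case: ifPn => t0.
  transitivity (\int[mu]_(x in `[0%R, t]) (g t)%:E)%E.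
    rewrite [RHS]integral_mkcond; apply: eq_integral => x _.
    by rewrite patchE mem_setE in_itv /F/=; case: ifPn.
  rewrite integral_cst//= lebesgue_measure_itv/= lte_fin.
  move: t0; rewrite le_eqVlt => /predU1P[<-|t0]; first by rewrite ltxx mule0 mul0r.
  by rewrite t0 -EFinB -EFinM subr0 mulrC.
rewrite /F/= integral0_eq// => x _; case: ifPn => // /andP[x0 xt].
by move: t0; rewrite (le_trans x0 xt).
Qed.

(** The integrand has the primitive [- phi], which vanishes at infinity. *)
Lemma normal_pdf_tail x : 0 <= x ->
  (\int[mu]_(t in `[x, +oo[) (t / s ^+ 2 * phi t)%:E = (phi x)%:E)%E.
Proof.
move=> x0.
have cphi : continuous phi by exact: continuous_normal_pdf.
have cg : continuous (fun t : R => t / s ^+ 2 * phi t).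
  by move=> t; apply: cvgM; [apply: cvgM; [exact: cvg_id|exact: cvg_cst]|exact: cphi].
have dphi (t : R) : is_derive t 1 (fun t => - phi t) (t / s ^+ 2 * phi t).
  have -> : (fun t => - phi t) = (fun t => - normal_peak s * expR (- (s ^+ 2 *+ 2)^-1 * t ^+ 2)).
    by apply/funext => y; rewrite normal_pdf0E mulNr [y ^+ 2 / _]mulrC mulNr.
  apply: is_derive_eq.
  have scaleE (y z : R) : y *: z = y * z by [].
  rewrite !scaleE mulr1 normal_pdf0E [t ^+ 2 / _]mulrC -[in RHS]mulNr.
  by set E := expR _; field.
rewrite (@ge0_continuous_FTC2y R (fun t => t / s ^+ 2 * phi t) (fun t => - phi t) x 0).
- by rewrite sub0e EFinN oppeK.
- by move=> t xt; rewrite !mulr_ge0 ?normal_pdf_ge0 ?invr_ge0 ?sqr_ge0// (le_trans x0).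
- apply: continuous_subspaceT => t; exact: cg.
- rewrite -[X in _ --> X]oppr0; apply: cvgN.
  have h : expR (- (y ^+ 2 / (s ^+ 2 *+ 2))) @[y --> +oo] --> (0 : R).
    apply: (cvg_comp (fun y : R => y ^+ 2 / (s ^+ 2 *+ 2)) (fun y => expR (- y))).
      apply: gt0_cvgMly; last exact: cvgr_expr2.
      by rewrite invr_gt0 pmulrn_lgt0// exprn_gt0.
    exact: cvgr_expR.
  have -> : phi = fun y => normal_peak s * expR (- (y ^+ 2 / (s ^+ 2 *+ 2))).
    by apply/funext => y; rewrite normal_pdf0E.
  have := cvgM (cvg_cst (normal_peak s)) h.
  by rewrite mulr0; apply.
- by move=> t _; exact: (@ex_derive _ _ _ _ _ _ _ (dphi t)).
- apply: cvgN; apply: cvg_at_right_filter; exact: cphi.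
- by move=> t _; rewrite derive1E (@derive_val _ _ _ _ _ _ _ (dphi t)).
Qed.

(** Writing [phi] on the half-line as its tail integral and exchanging the integrals turns the mass
    1/2 of the half-line into the integral of [t^2 / s^2] against [phi]. *)
Lemma normal_second_moment : (\int[gamma]_x (x ^+ 2)%:E = (s ^+ 2)%:E)%E.
Proof.
have cphi : continuous phi by exact: continuous_normal_pdf.
have mphi : measurable_fun setT phi by exact: measurable_normal_pdf.
have phi0 := normal_pdf_ge0 0 s.
have posE : [set x : R | 0 <= x] = `[0, +oo[%classic.
  by apply/seteqP; split => x /=; rewrite in_itv/= andbT.
have half : (2%:E * \int[mu]_(x in `[0%R, +oo[) (phi x)%:E = 1)%E.
  rewrite -(@integral_normal_pdf R 0 s) (@ge0_symfun_integralT R phi)// ?posE//.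
  by move=> x /=; rewrite normal_pdf_even.
have tail : (\int[mu]_(x in `[0%R, +oo[) (phi x)%:E =
    \int[mu]_(t in `[0%R, +oo[) (t * (t / s ^+ 2 * phi t))%:E)%E.
  rewrite -ge0_tonelli_halfline.
  - by apply: eq_integral => x; rewrite inE/= in_itv/= andbT => /normal_pdf_tail ->.
  - by meas.
  - by move=> t t0; rewrite !mulr_ge0// ?invr_ge0 ?sqr_ge0.
rewrite ge0_integral_normal_prob; [|emeas|by move=> x; rewrite lee_fin sqr_ge0].
rewrite (@ge0_symfun_integralT R (fun x => x ^+ 2 * phi x)); last 3 first.
- by move=> x; rewrite mulr_ge0// sqr_ge0.
- move=> x; apply: cvgM; [exact: exprn_continuous|exact: cphi].
- by move=> x /=; rewrite normal_pdf_even sqrrN.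
rewrite posE -[RHS]mule1 -half tail muleCA; congr (_ * _)%E.
rewrite -ge0_integralZl//.
- by apply: eq_integral => t _; rewrite -EFinM; congr EFin; field.
- by emeas.
- by move=> t _; rewrite lee_fin mulrA mulr_ge0// mulrA mulr_ge0 ?invr_ge0 ?sqr_ge0// -expr2 sqr_ge0.
- by rewrite lee_fin sqr_ge0.
Qed.

Section normal_random_variable.
Context d (T : measurableType d) (Q : probability T R) (Z : {RV Q >-> R}).
Hypothesis normalZ : is_normal 0 s Z.

Lemma ge0_expectation_normal (h : R -> \bar R) :
  measurable_fun setT h -> (forall x, 0 <= h x)%E ->
  (\int[Q]_w h (Z w) = \int[gamma]_x h x)%E.
Proof.
move=> mh h0.
have mZ : measurable_fun setT (Z : T -> measurableTypeR R) by exact: (@measurable_funPT _ _ _ _ Z).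
have mh' : measurable_fun setT (h : measurableTypeR R -> \bar R) by exact: mh.
rewrite -[LHS](ge0_integral_distribution (mfun_of mZ : {RV Q >-> _}) mh' h0).
by apply: eq_measure_integral => A mA _; exact: normalZ.
Qed.

Lemma normal_integrable_sqr : Q.-integrable setT (EFin \o (fun w => Z w ^+ 2)).
Proof.
apply/ge0_integrableP => [|w|]; [by meas|exact: sqr_ge0|].
rewrite (ge0_expectation_normal (h := fun x => (x ^+ 2)%:E)); last 2 first.
- by emeas.
- by move=> x; rewrite lee_fin sqr_ge0.
by rewrite normal_second_moment ltry.
Qed.

Lemma normal_variance : \int[Q]_w (Z w ^+ 2) = s ^+ 2.
Proof.
rewrite /Rintegral (ge0_expectation_normal (h := fun x => (x ^+ 2)%:E)); last 2 first.
- by emeas.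
- by move=> x; rewrite lee_fin sqr_ge0.
by rewrite normal_second_moment.
Qed.

Lemma normal_integrable : Q.-integrable setT (EFin \o Z).
Proof.
apply: (@integrable_dominated _ _ _ _ _ (fun w => 1 + Z w ^+ 2)) => //.
- by move=> w; rewrite -real_normK ?num_real//; have := normr_ge0 (Z w); nra.
- by apply: integrableDR; [exact: integrable_cstR|exact: normal_integrable_sqr].
Qed.

(** The density is even, so the positive and negative parts have equal integrals. *)
Lemma normal_mean : \int[Q]_w Z w = 0.
Proof.
have mE : measurable_fun setT (EFin : R -> \bar R) by exact/measurable_EFinP.
have Zfin := integrable_pos_fin_num measurableT normal_integrable.
rewrite /Rintegral integralE.
have posE w : ((EFin \o Z)^\+ w = EFin^\+ (Z w))%E by rewrite !funeposE.
have negE w : ((EFin \o Z)^\- w = EFin^\- (Z w))%E by rewrite !funenegE.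
have eqpn : (\int[Q]_w (EFin \o Z)^\- w = \int[Q]_w (EFin \o Z)^\+ w)%E.
  under eq_integral do rewrite negE.
  under [RHS]eq_integral do rewrite posE.
  rewrite (ge0_expectation_normal (h := (EFin^\-)%E))//; last exact: measurable_funeneg.
  rewrite (ge0_expectation_normal (h := (EFin^\+)%E))//; last exact: measurable_funepos.
  rewrite -[RHS]ge0_integral_normal_oppr//; last exact: measurable_funepos.
  by apply: eq_integral => x _; rewrite funenegE funeposE EFinN.
by rewrite -[X in (_ - X)%E]/(\int[Q]_w (EFin \o Z)^\- w)%E eqpn subee.
Qed.

End normal_random_variable.

End normal_law.

(** * Lindeberg replacement *)

(** The order of the second-order Taylor remainder of a function with bounded derivatives: cubic
    near 0, but quadratic at infinity, hence integrable under a second moment. *)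
Definition cubic_min (R : realType) (h : R) : R := Num.min (`|h| ^+ 3) (h ^+ 2).

(* [g1] and [g2] play the role of the first two derivatives of [g]; stating the
   expansion rather than differentiability makes the class stable under
   averaging. *)
Definition taylor_class (R : realType) (K : R) (g g1 g2 : R -> R) : Prop :=
  [/\ [/\ measurable_fun setT g, measurable_fun setT g1 & measurable_fun setT g2],
      forall x, [/\ `|g x| <= K, `|g1 x| <= K & `|g2 x| <= K]
    & forall x h, `|g (x + h) - (g x + g1 x * h + g2 x * (h ^+ 2 / 2))|
                  <= K * cubic_min h].

Section taylor_step.
Context d (T : measurableType d) (R : realType) (P : probability T R).

Lemma cubic_min_ge0 (h : R) : 0 <= cubic_min h.
Proof. by rewrite /cubic_min le_min exprn_ge0//= sqr_ge0. Qed.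

Lemma cubic_min_le_sqr (h : R) : cubic_min h <= h ^+ 2.
Proof. by rewrite /cubic_min ge_min lexx orbT. Qed.

Lemma measurable_cubic_min : measurable_fun setT (@cubic_min R).
Proof.
apply: measurable_minr; last exact: measurable_funX.
by apply: measurable_funX; exact: normr_measurable.
Qed.

Lemma integrable_sqr1 (f : T -> R) : measurable_fun setT f ->
  P.-integrable setT (EFin \o (fun w => f w ^+ 2)) -> P.-integrable setT (EFin \o f).
Proof.
move=> mf f2; apply: (@integrable_dominated _ _ _ _ _ (fun w => 1 + f w ^+ 2)) => //.
- by move=> w; rewrite -real_normK ?num_real//; have := normr_ge0 (f w); nra.
- by apply: integrableDR => //; exact: integrable_cstR.
Qed.

Lemma integrable_cubic_min (f : T -> R) (c : R) : measurable_fun setT f ->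
  P.-integrable setT (EFin \o (fun w => f w ^+ 2)) ->
  P.-integrable setT (EFin \o (fun w => cubic_min (c * f w))).
Proof.
move=> mf f2; apply: (@integrable_dominated _ _ _ _ _ (fun w => c ^+ 2 * f w ^+ 2)).
- by apply: (measurableT_comp measurable_cubic_min); exact: measurable_funM.
- by move=> w; rewrite ger0_norm ?cubic_min_ge0// -exprMn cubic_min_le_sqr.
- exact: integrableZR.
Qed.

(** Independence makes the linear term vanish and the quadratic one factor, so up to the remainder
    only the variance of [V] is seen. Two centered variables of the same variance are therefore
    interchangeable. *)
Lemma taylor_expectation (K c v : R) (g g1 g2 : R -> R) (U V : {RV P >-> R}) :
  taylor_class K g g1 g2 -> indep2 P U V ->
  P.-integrable setT (EFin \o (fun w => V w ^+ 2)) ->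
  \int[P]_w V w = 0 -> \int[P]_w (V w ^+ 2) = v ->
  `|\int[P]_w g (U w + c * V w) - (\int[P]_w g (U w) + c ^+ 2 * v / 2 * \int[P]_w g2 (U w))|
  <= K * \int[P]_w cubic_min (c * V w).
Proof.
move=> [[mg mg1 mg2] gK rem] UV V2 V0 Vv.
have V1 : P.-integrable setT (EFin \o V) by exact: integrable_sqr1.
have bdd (f : R -> R) (W : T -> R) : measurable_fun setT W -> measurable_fun setT f ->
    (forall x, `|f x| <= K) -> P.-integrable setT (EFin \o (fun w => f (W w))).
  move=> mW mf fK; apply: (@integrable_ubound _ _ _ _ _ K) => [|w //].
  exact: (measurableT_comp mf mW).
have mUcV : measurable_fun setT (fun w => U w + c * V w).
  by apply: measurable_funD => //; exact: measurable_funM.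
have gU : P.-integrable setT (EFin \o (g \o U)).
  by apply: bdd => // x; have [] := gK x.
have g1U : P.-integrable setT (EFin \o (g1 \o U)).
  by apply: bdd => // x; have [] := gK x.
have g2U : P.-integrable setT (EFin \o (g2 \o U)).
  by apply: bdd => // x; have [] := gK x.
have gUV : P.-integrable setT (EFin \o (fun w => g (U w + c * V w))).
  by apply: bdd => // x; have [] := gK x.
have [I1 E1] := integrable_mul_indep2 (h := id) UV mg1 (@measurable_id _ _ _) g1U V1.
have msq : measurable_fun setT (fun x : R => x ^+ 2) by exact: measurable_funX.
have [I2 E2] := integrable_mul_indep2 (h := fun x => x ^+ 2) UV mg2 msq g2U V2.
rewrite /= V0 mulr0 in E1.
rewrite Vv in E2.
pose L w := g (U w) + (c * (g1 (U w) * V w) + c ^+ 2 / 2 * (g2 (U w) * V w ^+ 2)).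
have cI1 := integrableZR c I1.
have cI2 := integrableZR (c ^+ 2 / 2) I2.
have Li : P.-integrable setT (EFin \o L).
  by apply: integrableDR => //; exact: integrableDR.
have -> : \int[P]_w g (U w) + c ^+ 2 * v / 2 * \int[P]_w g2 (U w) = \int[P]_w L w.
  rewrite RintegralD//; last exact: integrableDR.
  rewrite RintegralD// !RintegralZl// E1 E2 mulr0 add0r; congr (_ + _).
  by rewrite mulrA -mulrA [RHS]mulrAC mulrA; congr (_ * _); ring.
rewrite -RintegralB//.
have mVc := integrable_cubic_min c (measurable_funPT V) V2.
apply: (le_trans (le_normr_Rintegral _ _)) => //.
  exact: (integrableB measurableT gUV Li).
rewrite -RintegralZl//; apply: le_Rintegral => //.
- apply: integrable_norm; exact: (integrableB measurableT gUV Li).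
- exact: integrableZR.
- move=> w _; apply: le_trans (rem (U w) (c * V w)).
  rewrite le_eqVlt; apply/orP; left; apply/eqP; congr (`| _ - _|).
  by rewrite /L -addrA; congr (_ + (_ + _)); [ring|field].
Qed.

Lemma indep2_cst (x : R) (V : T -> R) : indep2 P (fun=> x) V.
Proof.
move=> A B mA mB; have [xA|xA] := pselect (A x).
  rewrite (_ : (fun=> x) @^-1` A = setT); last by apply/seteqP; split.
  by rewrite setTI probability_setT mul1e.
rewrite (_ : (fun=> x) @^-1` A = set0); last by apply/seteqP; split.
by rewrite set0I measure0 mul0e.
Qed.

Lemma indep2_comp (f : R -> R) (U V : T -> R) : measurable_fun setT f ->
  indep2 P U V -> indep2 P (f \o U) V.
Proof.
move=> mf UV A B mA mB; apply: (UV (f @^-1` A) B) => //.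
by rewrite -[_ @^-1` _]setTI; exact: mf.
Qed.

End taylor_step.

Section averaging.
Context d (T : measurableType d) (R : realType) (Q : probability T R).
Variable Z : {RV Q >-> R}.

(** The effect on a test function of adding an independent copy of [c * Z], expressed without a
    space that carries such copies. *)
Definition average (c : R) (g : R -> R) (x : R) : R := \int[Q]_w g (x + c * Z w).

Let mZ c x : measurable_fun setT (fun w => x + c * Z w).
Proof. by apply: measurable_funD => //; exact: measurable_funM. Qed.

Lemma bounded_integrable_average (c x K : R) (g : R -> R) : measurable_fun setT g ->
  (forall x, `|g x| <= K) -> Q.-integrable setT (EFin \o (fun w => g (x + c * Z w))).
Proof.
move=> mg gK; apply: (@integrable_ubound _ _ _ _ _ K) => [|w //].
exact: (measurableT_comp mg (mZ c x)).
Qed.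

Lemma measurable_average (c K : R) (g : R -> R) : measurable_fun setT g ->
  (forall x, `|g x| <= K) -> measurable_fun setT (average c g).
Proof.
move=> mg gK.
(* Measurability in the parameter comes from Tonelli, for nonnegative functions; hence the shift by
   [K]. *)
have gK0 x : 0 <= g x + K.
  by have := gK x; rewrite ler_norml => /andP[]; rewrite -subr_ge0 opprK.
pose F (z : R * T) : \bar R := (g (z.1 + c * Z z.2) + K)%:E.
have mF : measurable_fun setT F.
  apply/measurable_EFinP; apply: measurable_funD => //.
  apply: (measurableT_comp mg); apply: measurable_funD => //.
  by apply: measurable_funM => //; apply: measurableT_comp.
have F0 z : (0 <= F z)%E by rewrite lee_fin.
have mI := @measurable_fun_fubini_tonelli_F _ _ _ _ _ Q F mF F0.
have -> : average c g = (fun x => fine (fubini_F Q F x) - K).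
  apply/funext => x; rewrite /fubini_F /F -/(Rintegral _ _ _) RintegralD//.
  - by rewrite Rintegral_cstT addrK.
  - exact: bounded_integrable_average.
  - exact: integrable_cstR.
by apply: measurable_funB => //; exact: measurableT_comp.
Qed.

Lemma average_bound (c K : R) (g : R -> R) : measurable_fun setT g ->
  (forall x, `|g x| <= K) -> forall x, `|average c g x| <= K.
Proof.
move=> mg gK x; have gi := bounded_integrable_average c x mg gK.
apply: (le_trans (le_normr_Rintegral _ _)) => //.
rewrite -[leRHS](Rintegral_cstT Q); apply: le_Rintegral => //.
- exact: integrable_norm.
- exact: integrable_cstR.
Qed.

(** The expansion at [x + c * Z w] is integrated over [w]. Since [Q] has mass 1 the constant [K] is
    unchanged, so the errors do not grow along the iteration. *)
Lemma taylor_class_average (c K : R) (g g1 g2 : R -> R) : taylor_class K g g1 g2 ->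
  taylor_class K (average c g) (average c g1) (average c g2).
Proof.
move=> [[mg mg1 mg2] gK rem].
have bg x : `|g x| <= K by have [] := gK x.
have bg1 x : `|g1 x| <= K by have [] := gK x.
have bg2 x : `|g2 x| <= K by have [] := gK x.
split.
- by split; apply: (@measurable_average _ K).
- by move=> x; split; exact: average_bound.
move=> x h.
have gi y := bounded_integrable_average c y mg bg.
have g1i y := bounded_integrable_average c y mg1 bg1.
have g2i y := bounded_integrable_average c y mg2 bg2.
have h1i := integrableZR h (g1i x).
have h2i := integrableZR (h ^+ 2 / 2) (g2i x).
pose L w := g (x + c * Z w) + (h * g1 (x + c * Z w) + h ^+ 2 / 2 * g2 (x + c * Z w)).
have Li : Q.-integrable setT (EFin \o L).
  by apply: integrableDR => //; exact: integrableDR.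
have -> : average c g x + average c g1 x * h + average c g2 x * (h ^+ 2 / 2) =
    \int[Q]_w L w.
  rewrite RintegralD//; last exact: integrableDR.
  rewrite RintegralD// !RintegralZl// -addrA; congr (_ + (_ + _)); exact: mulrC.
rewrite /average -RintegralB//.
have Di := integrableB measurableT (gi (x + h)) Li.
apply: (le_trans (le_normr_Rintegral _ Di)) => //.
rewrite -[leRHS](Rintegral_cstT Q); apply: le_Rintegral => //.
- exact: (integrable_norm Di).
- exact: integrable_cstR.
- move=> w _; apply: le_trans (rem (x + c * Z w) h).
  rewrite le_eqVlt; apply/orP; left; apply/eqP; congr (`| g _ - _|); first by ring.
  by rewrite /L -addrA; congr (_ + (_ + _)); exact: mulrC.
Qed.

(** The case of [taylor_expectation] where [U] is constant. *)
Lemma average_taylor (K c v : R) (g g1 g2 : R -> R) : taylor_class K g g1 g2 ->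
  Q.-integrable setT (EFin \o (fun w => Z w ^+ 2)) ->
  \int[Q]_w Z w = 0 -> \int[Q]_w (Z w ^+ 2) = v ->
  forall x, `|average c g x - (g x + c ^+ 2 * v / 2 * g2 x)| <=
    K * \int[Q]_w cubic_min (c * Z w).
Proof.
move=> Kg Z2 Z0 Zv x.
pose U : {RV Q >-> R} := mfun_of (@measurable_cst _ _ T R setT x).
have := taylor_expectation (U := U) c Kg (indep2_cst _ _ _) Z2 Z0 Zv.
by rewrite /= !Rintegral_cstT.
Qed.

End averaging.

Section central_limit.
Context d (T : measurableType d) d' (T' : measurableType d') (R : realType)
  (P : probability T R) (Q : probability T' R).
Variables (X : nat -> {RV P >-> R}) (Z : {RV Q >-> R}) (v : R).
Hypothesis Xiid : iid X.
Hypothesis X2 : P.-integrable setT (EFin \o (fun w => X 0%N w ^+ 2)).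
Hypothesis EX : \int[P]_w X 0%N w = 0.
Hypothesis EX2 : \int[P]_w (X 0%N w ^+ 2) = v.
Hypothesis Z2 : Q.-integrable setT (EFin \o (fun w => Z w ^+ 2)).
Hypothesis EZ : \int[Q]_w Z w = 0.
Hypothesis EZ2 : \int[Q]_w (Z w ^+ 2) = v.

(** Both means have the same second-order expansion around [c * psum X k], since [X k] and [Z] share
    mean and variance; only the two remainders are left. *)
Lemma replacement_step (K c : R) (g g1 g2 : R -> R) (k : nat) :
  taylor_class K g g1 g2 ->
  `|\int[P]_w g (c * psum X k.+1 w) - \int[P]_w average Z c g (c * psum X k w)| <=
  K * (\int[P]_w cubic_min (c * X 0%N w) + \int[Q]_w cubic_min (c * Z w)).
Proof.
move=> Kg; have [[mg mg1 mg2] gK _] := Kg.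
have bg x : `|g x| <= K by have [] := gK x.
have bg2 x : `|g2 x| <= K by have [] := gK x.
have [iX /(_ k) Xk] := Xiid.
have X0k : same_distribution (X 0%N) (X k) by move=> A mA; rewrite Xk.
have msq : measurable_fun setT (fun x : R => x ^+ 2) by exact: measurable_funX.
have X1 : P.-integrable setT (EFin \o X 0%N) by exact: integrable_sqr1.
have Xk2 := same_distribution_integrable X0k (h := fun x => x ^+ 2) msq X2.
have EXk : \int[P]_w X k w = 0.
  by rewrite -EX; apply/esym; exact: (same_distribution_Rintegral X0k (h := id)).
have EXk2 : \int[P]_w (X k w ^+ 2) = v.
  by rewrite -EX2; apply/esym; exact: (same_distribution_Rintegral X0k (h := fun x => x ^+ 2)).
have mmin : measurable_fun setT (fun x : R => cubic_min (c * x)).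
  by apply: (measurableT_comp (@measurable_cubic_min R)); exact: measurable_funM.
have Emin : \int[P]_w cubic_min (c * X 0%N w) = \int[P]_w cubic_min (c * X k w).
  apply: (same_distribution_Rintegral X0k (h := fun x => cubic_min (c * x))) => //.
  exact: integrable_cubic_min.
have mc : measurable_fun setT (fun x : R => c * x) by exact: measurable_funM.
have mU : measurable_fun setT ((fun x : R => c * x) \o psum X k) by exact: measurableT_comp.
pose U : {RV P >-> R} := mfun_of mU.
have UXk : indep2 P U (X k).
  by apply: (indep2_comp mc); exact: indep2_psum.
have step1 := taylor_expectation c Kg UXk Xk2 EXk EXk2.
have step2 := average_taylor c Kg Z2 EZ EZ2.
have bdd (f : R -> R) : measurable_fun setT f ->
    (forall x, `|f x| <= K) -> P.-integrable setT (EFin \o (fun w => f (c * psum X k w))).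
  move=> mf fK; apply: (@integrable_ubound _ _ _ _ _ K) => [|w //].
  exact: (measurableT_comp mf mU).
have mav := measurable_average Z c mg bg.
have bav := average_bound Z c mg bg.
have gi := bdd _ mg bg; have g2i := bdd _ mg2 bg2; have avi := bdd _ mav bav.
have step3 : `|\int[P]_w average Z c g (c * psum X k w) -
   (\int[P]_w g (c * psum X k w) + c ^+ 2 * v / 2 * \int[P]_w g2 (c * psum X k w))| <=
   K * \int[Q]_w cubic_min (c * Z w).
  have cg2i := integrableZR (c ^+ 2 * v / 2) g2i.
  have si := integrableDR gi cg2i.
  rewrite -RintegralZl// -RintegralD// -RintegralB//.
  have Di := integrableB measurableT avi si.
  apply: (le_trans (le_normr_Rintegral _ Di)) => //.
  rewrite -[leRHS](Rintegral_cstT P); apply: le_Rintegral => //.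
  - exact: (integrable_norm Di).
  - exact: integrable_cstR.
rewrite Emin mulrDr.
have -> : \int[P]_w g (c * psum X k.+1 w) = \int[P]_w g (U w + c * X k w).
  by congr Rintegral; apply/funext => w; rewrite psumS mulrDr.
rewrite (le_trans _ (lerD step1 step3))//.
rewrite [X in _ <= _ + X]distrC (le_trans _ (ler_normD _ _))// le_eqVlt.
by apply/orP; left; apply/eqP; congr `| _ |; rewrite /=; ring.
Qed.

(** The last variable is replaced first, and the induction hypothesis is applied to the averaged
    function; this is why the induction generalizes over [g]. *)
Lemma replacement_sum (K c : R) (g g1 g2 : R -> R) (n : nat) :
  taylor_class K g g1 g2 ->
  `|\int[P]_w g (c * psum X n w) - iter n (average Z c) g 0| <=
  n%:R * (K * (\int[P]_w cubic_min (c * X 0%N w) + \int[Q]_w cubic_min (c * Z w))).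
Proof.
elim: n g g1 g2 => [|n IHn] g g1 g2 Kg.
  rewrite mul0r (_ : (fun w => g (c * psum X 0 w)) = fun=> g 0).
    by rewrite Rintegral_cstT subrr normr0.
  by apply/funext => w; rewrite psum0 mulr0.
have := IHn _ _ _ (taylor_class_average Z c Kg).
have := replacement_step c n Kg.
move=> h1 h2; rewrite iterSr -natr1 mulrDl mul1r.
rewrite (le_trans _ (lerD h2 h1))// addrC (le_trans _ (ler_normD _ _))// le_eqVlt.
by apply/orP; left; apply/eqP; congr `| _ |; ring.
Qed.

(** After multiplication by [n] the integrand is the minimum of [|f|^3 / sqrt n] and [f^2] for
    positive [n]: it tends to 0 and is dominated by [f^2]. *)
Lemma cvg_cubic_min_sum d0 (S : measurableType d0) (M : probability S R)
    (f : S -> R) : measurable_fun setT f ->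
  M.-integrable setT (EFin \o (fun w => f w ^+ 2)) ->
  n%:R * \int[M]_w cubic_min ((Num.sqrt n%:R)^-1 * f w) @[n --> \oo] --> (0 : R).
Proof.
move=> mf f2.
have E : (fun n : nat => n%:R * \int[M]_w cubic_min ((Num.sqrt n%:R)^-1 * f w)) =
    fun n => \int[M]_w (n%:R * cubic_min ((Num.sqrt n%:R)^-1 * f w)).
  by apply/funext => n; rewrite RintegralZl//; exact: integrable_cubic_min.
rewrite E -(Rintegral_cstT M 0).
apply: (Rintegral_dominated_cvg (g := fun w => f w ^+ 2)) => //.
- move=> n; apply: measurable_funM => //.
  by apply: (measurableT_comp (@measurable_cubic_min R)); exact: measurable_funM.
- apply: aeW => w; apply/cvgrPdist_le => e e0.
  (* The square is the threshold for [|f w|^3 / sqrt n <= e]; the summand 1 makes [n] positive. *)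
  have : \forall n \near \oo, (`|f w| ^+ 3 / e) ^+ 2 + 1 <= n%:R by exact: nbhs_infty_ger.
  apply: filterS => n; set a := `|f w| => nfe.
  have a0 : 0 <= a by exact: normr_ge0.
  have n0 : 0 < n%:R :> R by apply: lt_le_trans nfe; rewrite ltr_wpDl// sqr_ge0.
  have sn0 : 0 < Num.sqrt n%:R :> R by rewrite sqrtr_gt0.
  rewrite sub0r normrN ger0_norm ?mulr_ge0 ?cubic_min_ge0//.
  apply: (@le_trans _ _ (n%:R * `|(Num.sqrt n%:R)^-1 * f w| ^+ 3)).
    by rewrite ler_wpM2l// /cubic_min ge_min lexx.
  rewrite normrM normfV (gtr0_norm sn0) -/a -[X in X * _](sqr_sqrtr (ltW n0)).
  have -> : Num.sqrt n%:R ^+ 2 * ((Num.sqrt n%:R)^-1 * a) ^+ 3 = a ^+ 3 / Num.sqrt n%:R.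
    by field; rewrite gt_eqF.
  rewrite ler_pdivrMr// mulrC -ler_pdivrMr// -[leLHS]ger0_norm; last first.
    by rewrite divr_ge0 ?exprn_ge0// ltW.
  by rewrite -sqrtr_sqr ler_wsqrtr// (le_trans _ nfe)// lerDl.
- move=> n w; rewrite ger0_norm ?mulr_ge0 ?cubic_min_ge0//.
  have [->|n0] := posnP n; first by rewrite mul0r sqr_ge0.
  apply: (le_trans (ler_wpM2l (ler0n _ _) (cubic_min_le_sqr _))).
  rewrite exprMn exprVn sqr_sqrtr ?ler0n// mulrA divff ?mul1r//.
  by rewrite pnatr_eq0 -lt0n.
Qed.

End central_limit.

Section normal_limit.
Context d (T : measurableType d) d' (T' : measurableType d') (R : realType)
  (P : probability T R) (Q : probability T' R).
Variables (X : nat -> {RV P >-> R}) (Z : {RV Q >-> R}) (s : R).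
Hypothesis s0 : 0 < s.
Hypothesis normalZ : is_normal 0 s Z.

(** Variances add under convolution, so the scale grows like a square root. The count starts at 1
    because [normal_convolution] asks for positive scales. *)
Lemma iter_average_normal (c K : R) (g g1 g2 : R -> R) (n : nat) (x : R) : 0 < c ->
  taylor_class K g g1 g2 -> (forall y, 0 <= g y) ->
  iter n.+1 (average Z c) g x = \int[Q]_w g (x + (c * Num.sqrt n.+1%:R) * Z w).
Proof.
move=> c0 Kg g0; have [[mg _ _] gK _] := Kg.
have bg y : `|g y| <= K by have [] := gK y.
elim: n x => [|n IHn] x; first by rewrite /= sqrtr1 mulr1.
rewrite iterS {1}/average.
have c1 : 0 < c * Num.sqrt n.+1%:R by rewrite mulr_gt0// sqrtr_gt0.
have c2 : 0 < c * Num.sqrt n.+2%:R by rewrite mulr_gt0// sqrtr_gt0.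
have e2 : (c * Num.sqrt n.+2%:R) ^+ 2 = c ^+ 2 + (c * Num.sqrt n.+1%:R) ^+ 2.
  by rewrite !exprMn !sqr_sqrtr ?ler0n// -[in LHS]natr1 mulrDr mulr1 addrC.
have h := @normal_convolution R s s0 g x _ _ _ c0 c1 c2 e2 mg g0.
have maff y b : measurable_fun setT (fun z : R => (g (y + b * z))%:E).
  by emeas.
congr fine.
rewrite [RHS](@ge0_expectation_normal _ _ _ _ _ Z normalZ (fun z => (g (x + c * Num.sqrt n.+2%:R * z))%:E))//; last first.
  by move=> y; rewrite lee_fin.
rewrite -h.
rewrite -(@ge0_expectation_normal _ _ _ _ _ Z normalZ (fun z => \int[normal_prob 0 s]_w (g (x + c * z + c * Num.sqrt n.+1%:R * w))%:E)%E); last 2 first.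
- pose F (zw : R * measurableTypeR R) : \bar R :=
    (g (x + c * zw.1 + c * Num.sqrt n.+1%:R * zw.2))%:E.
  have mF0 : measurable_fun setT (fun zw : R * R =>
    (g (x + c * zw.1 + c * Num.sqrt n.+1%:R * zw.2))%:E) by emeas.
  have mF : measurable_fun setT F by exact: mF0.
  apply: (@measurable_fun_fubini_tonelli_F _ _ _ _ _ (normal_prob 0 s) F mF).
  by move=> z; rewrite lee_fin.
- by move=> z; apply: integral_ge0 => w _; rewrite lee_fin.
apply: eq_integral => w _; rewrite IHn.
rewrite EFin_Rintegral; last exact: bounded_integrable_average.
rewrite (@ge0_expectation_normal _ _ _ _ _ Z normalZ (fun z => (g (x + c * Z w + c * Num.sqrt n.+1%:R * z))%:E))//.
by move=> y; rewrite lee_fin.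
Qed.

Lemma cvg_taylor_expectation (K : R) (g g1 g2 : R -> R) :
  iid X -> P.-integrable setT (EFin \o (fun w => X 0%N w ^+ 2)) ->
  \int[P]_w X 0%N w = 0 -> \int[P]_w (X 0%N w ^+ 2) = s ^+ 2 ->
  taylor_class K g g1 g2 -> (forall y, 0 <= g y) ->
  \int[P]_w g (psum X n w / Num.sqrt n%:R) @[n --> \oo] --> \int[Q]_w g (Z w).
Proof.
move=> Xiid X2 X0 Xs Kg g0.
have Z2 := normal_integrable_sqr s0 normalZ.
have Z0 := normal_mean s0 normalZ.
have Zs := normal_variance s0 normalZ.
have cX := cvg_cubic_min_sum (measurable_funPT (X 0%N)) X2.
have cZ := cvg_cubic_min_sum (measurable_funPT Z) Z2.
have K0 : 0 <= K by have [_ /(_ 0)[h _ _] _] := Kg; exact: le_trans h.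
apply/cvgrPdist_le => e e0.
have e1 : 0 < e / (K + 1) / 2 by rewrite !divr_gt0// ltr_wpDl.
move/cvgrPdist_le : cX => /(_ _ e1) cX; move/cvgrPdist_le : cZ => /(_ _ e1) cZ.
near=> n.
have n0 : (0 < n)%N by near: n; exact: nbhs_infty_gt.
have cXn : `|0 - n%:R * \int[P]_w cubic_min ((Num.sqrt n%:R)^-1 * X 0%N w)| <= e / (K + 1) / 2.
  by near: n.
have cZn : `|0 - n%:R * \int[Q]_w cubic_min ((Num.sqrt n%:R)^-1 * Z w)| <= e / (K + 1) / 2.
  by near: n.
have sn0 : 0 < Num.sqrt n%:R :> R by rewrite sqrtr_gt0 ltr0n.
have c0 : 0 < (Num.sqrt n%:R)^-1 :> R by rewrite invr_gt0.
(* With scale [1 / sqrt n], the [n] averages amount to exactly one copy of [Z]. *)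
have iterE : iter n (average Z (Num.sqrt n%:R)^-1) g 0 = \int[Q]_w g (Z w).
  rewrite -(prednK n0) (iter_average_normal _ _ _ Kg)// prednK// mulVf ?gt_eqF//.
  by apply: eq_Rintegral => w _; rewrite add0r mul1r.
have RS := replacement_sum Xiid X2 X0 Xs Z2 Z0 Zs (Num.sqrt n%:R)^-1 n Kg.
rewrite iterE in RS.
rewrite distrC.
rewrite [X in `|X - _|](_ : _ = \int[P]_w g ((Num.sqrt n%:R)^-1 * psum X n w)); last first.
  by apply: eq_Rintegral => w _; rewrite mulrC.
apply: (le_trans RS); rewrite mulrCA mulrDr.
apply: (@le_trans _ _ (K * (e / (K + 1)))); last first.
  have K1 : 0 < K + 1 by rewrite ltr_wpDl.
  by rewrite mulrA ler_pdivrMr// mulrC ler_wpM2l ?lerDl// ltW.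
rewrite ler_wpM2l// [leRHS]splitr; apply: lerD.
  by apply: le_trans cXn; rewrite sub0r normrN ler_norm.
by apply: le_trans cZn; rewrite sub0r normrN ler_norm.
Unshelve. all: by end_near. Qed.

End normal_limit.

(** * Smooth steps and distribution functions *)

Section smooth_step.
Context (R : realType).
Implicit Types x h a b : R.

Definition pospart x : R := Num.max x 0.

(** The second derivative of the truncated cube is [6 * pospart x], which is Lipschitz with constant
    6. *)
Lemma pospart_cube_taylor x h :
  `|pospart (x + h) ^+ 3 - (pospart x ^+ 3 + 3 * pospart x ^+ 2 * h + 3 * pospart x * h ^+ 2)|
  <= `|h| ^+ 3.
Proof.
rewrite /pospart; have [x0|x0] := leP x 0; have [xh0|xh0] := leP (x + h) 0.
- by rewrite !expr0n/= !(mulr0, mul0r, addr0, subr0) normr0 exprn_ge0.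
- have h0 : 0 < h by lra.
  rewrite !expr0n/= !(mulr0, mul0r, addr0, subr0) ger0_norm ?exprn_ge0 ?(ltW xh0)//.
  by rewrite (gtr0_norm h0) lerXn2r ?nnegrE ?(ltW h0) ?(ltW xh0)//; lra.
- have h0 : h < 0 by lra.
  have -> : 0 ^+ 3 - (x ^+ 3 + 3 * x ^+ 2 * h + 3 * x * h ^+ 2) = h ^+ 3 - (x + h) ^+ 3 by ring.
  rewrite (ltr0_norm h0) ler_norml; apply/andP; split.
    have : 0 <= (- (x + h)) ^+ 3 by rewrite exprn_ge0//; lra.
    by rewrite (_ : (- (x + h)) ^+ 3 = - (x + h) ^+ 3); [rewrite (_ : (- h) ^+ 3 = - h ^+ 3); [lra|ring]|ring].
  have : (- (x + h)) ^+ 3 <= (- h) ^+ 3 by rewrite lerXn2r ?nnegrE//; lra.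
  have : 0 <= (- h) ^+ 3 by rewrite exprn_ge0//; lra.
  rewrite (_ : (- (x + h)) ^+ 3 = - (x + h) ^+ 3); last by ring.
  by rewrite (_ : (- h) ^+ 3 = - h ^+ 3); [lra|ring].
- have -> : (x + h) ^+ 3 - (x ^+ 3 + 3 * x ^+ 2 * h + 3 * x * h ^+ 2) = h ^+ 3 by ring.
  by rewrite normrX.
Qed.

(* A cubic B-spline: third differences of the truncated cube. *)
Definition step x := 1 - (pospart x ^+ 3 - 3 * pospart (x - 1) ^+ 3
  + 3 * pospart (x - 2) ^+ 3 - pospart (x - 3) ^+ 3) / 6.
Definition step1 x := - (pospart x ^+ 2 - 3 * pospart (x - 1) ^+ 2
  + 3 * pospart (x - 2) ^+ 2 - pospart (x - 3) ^+ 2) / 2.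
Definition step2 x := - (pospart x - 3 * pospart (x - 1)
  + 3 * pospart (x - 2) - pospart (x - 3)).

(** Between consecutive knots 0, 1, 2, 3 every truncated term is a polynomial, so case analysis
    leaves polynomial inequalities. *)
Variant step_spec x : R -> R -> R -> R -> Type :=
| StepSpec0 of x <= 0 : step_spec x 0 0 0 0
| StepSpec1 of 0 < x <= 1 : step_spec x x 0 0 0
| StepSpec2 of 1 < x <= 2 : step_spec x x (x - 1) 0 0
| StepSpec3 of 2 < x <= 3 : step_spec x x (x - 1) (x - 2) 0
| StepSpec4 of 3 < x : step_spec x x (x - 1) (x - 2) (x - 3).

Lemma stepP x : step_spec x (pospart x) (pospart (x - 1)) (pospart (x - 2)) (pospart (x - 3)).
Proof.
have E y : y <= 0 -> pospart y = 0 by move=> y0; rewrite /pospart; apply/max_idPr.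
have E' y : 0 < y -> pospart y = y by move=> y0; rewrite /pospart; apply/max_idPl/ltW.
have [x0|x0] := leP x 0.
  by rewrite !E; [constructor|lra..].
have [x1|x1] := leP x 1.
  by rewrite (E' x)// !E; [constructor; rewrite x0|lra..].
have [x2|x2] := leP x 2.
  by rewrite (E' x)// (E' (x - 1)) ?E; [constructor; rewrite x1|lra..].
have [x3|x3] := leP x 3.
  by rewrite (E' x)// (E' (x - 1)) ?(E' (x - 2)) ?E; [constructor; rewrite x2|lra..].
by rewrite !E'; [constructor|lra..].
Qed.

Lemma step_ge0 x : 0 <= step x.
Proof.
rewrite /step; case: stepP => [?|/andP[? ?]|/andP[? ?]|/andP[? ?]|?]; first by lra.
- have : x ^+ 3 <= 1 by rewrite exprn_ile1//; lra. by lra.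
(* With [y = 2 - x], here [6 * step x] equals [1 + 3 y + y^2 (3 - 2 y)]. *)
- have : 0 <= (2 - x) ^+ 2 * (3 - 2 * (2 - x)) by rewrite mulr_ge0 ?sqr_ge0//; lra.
  by lra.
- have : 0 <= (3 - x) ^+ 3 by rewrite exprn_ge0//; lra. by lra.
- by lra.
Qed.

Lemma step_le1 x : step x <= 1.
Proof.
rewrite /step; case: stepP => [?|/andP[? ?]|/andP[? ?]|/andP[? ?]|?]; first by lra.
- have : 0 <= x ^+ 3 by rewrite exprn_ge0//; lra. by lra.
- have : 0 <= (x - 1) ^+ 2 * (3 - 2 * (x - 1)) by rewrite mulr_ge0 ?sqr_ge0//; lra.
  by lra.
- have : (3 - x) ^+ 3 <= 1 by rewrite exprn_ile1//; lra. by lra.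
- by lra.
Qed.

Lemma step_eq1 x : x <= 0 -> step x = 1.
Proof. by move=> x0; rewrite /step; case: stepP => [?|/andP[? ?]|/andP[? ?]|/andP[? ?]|?]; lra. Qed.

Lemma step_eq0 x : 3 <= x -> step x = 0.
Proof.
move=> x3; rewrite /step; case: stepP => [?|/andP[]|/andP[]|/andP[h1 h2]|?]; try lra.
by have -> : x = 3; [lra|field].
Qed.

Lemma step1_bound x : `|step1 x| <= 1.
Proof.
rewrite /step1 ler_norml.
by case: stepP => [?|/andP[? ?]|/andP[? ?]|/andP[? ?]|?]; apply/andP; split; nra.
Qed.

Lemma step2_bound x : `|step2 x| <= 1.
Proof.
rewrite /step2 ler_norml.
by case: stepP => [?|/andP[? ?]|/andP[? ?]|/andP[? ?]|?]; apply/andP; split; lra.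
Qed.

(** The four truncated cubes contribute remainders with total weight [(1 + 3 + 3 + 1) / 6], which is
    below 2. *)
Lemma step_taylor x h :
  `|step (x + h) - (step x + step1 x * h + step2 x * (h ^+ 2 / 2))| <= 2 * `|h| ^+ 3.
Proof.
have T0 := pospart_cube_taylor x h.
have T1 := pospart_cube_taylor (x - 1) h.
have T2 := pospart_cube_taylor (x - 2) h.
have T3 := pospart_cube_taylor (x - 3) h.
have c y : x + h - y = x - y + h by ring.
rewrite /step /step1 /step2 !c.
move: T0 T1 T2 T3; rewrite !ler_norml.
move=> /andP[? ?] /andP[? ?] /andP[? ?] /andP[? ?].
by apply/andP; split; lra.
Qed.

Lemma measurable_pospartX y k : measurable_fun setT (fun x => pospart (x - y) ^+ k).
Proof. by apply: measurable_funX; apply: measurable_maxr => //; exact: measurable_funB. Qed.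

Lemma measurable_steps : [/\ measurable_fun setT step, measurable_fun setT step1
  & measurable_fun setT step2].
Proof.
have m k : measurable_fun setT (fun x => pospart x ^+ k - 3 * pospart (x - 1) ^+ k
    + 3 * pospart (x - 2) ^+ k - pospart (x - 3) ^+ k).
  have m0 : measurable_fun setT (fun x => pospart x ^+ k).
    by apply: measurable_funX; exact: measurable_maxr.
  apply: measurable_funB; last exact: measurable_pospartX.
  apply: measurable_funD; first apply: measurable_funB => //.
    by apply: measurable_funM => //; exact: measurable_pospartX.
  by apply: measurable_funM => //; exact: measurable_pospartX.
split.
- by apply: measurable_funB => //; apply: measurable_funM => //; exact: m.
- by apply: measurable_funM => //; apply: measurable_funN; exact: m.
- by apply: measurable_funN; exact: (m 1%N).
Qed.

Lemma taylor_class_step a b : 0 < b -> exists K g1 g2,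
  taylor_class K (fun x => step (b * (x - a))) g1 g2.
Proof.
(* [M] dominates the function, its two derivatives and the cubic remainder. The factor 4 below
   serves [|h| > 1], where each of the four terms of the remainder is at most [M * h ^+ 2]. *)
move=> b0; pose M := 1 + b + b ^+ 2 + 2 * b ^+ 3.
have b2 : 0 < b ^+ 2 by rewrite exprn_gt0.
have b3 : 0 < b ^+ 3 by rewrite exprn_gt0.
exists (4 * M), (fun x => b * step1 (b * (x - a))), (fun x => b ^+ 2 * step2 (b * (x - a))).
have B0 x : `|step x| <= M.
  by rewrite ger0_norm ?step_ge0// (le_trans (step_le1 x))// /M; lra.
have B1 x : `|b * step1 x| <= M.
  rewrite normrM (gtr0_norm b0) (@le_trans _ _ b)//; last by rewrite /M; lra.
  by rewrite ler_piMr ?step1_bound// ltW.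
have B2 x : `|b ^+ 2 * step2 x| <= M.
  rewrite normrM (gtr0_norm b2) (@le_trans _ _ (b ^+ 2))//; last by rewrite /M; lra.
  by rewrite ler_piMr ?step2_bound// ltW.
have M0 : 0 <= M by exact: le_trans (B0 0).
have M4 : M <= 4 * M by lra.
split.
- have [m0 m1 m2] := measurable_steps.
  have mb : measurable_fun setT (fun x => b * (x - a)).
    by apply: measurable_funM => //; exact: measurable_funB.
  split; first exact: measurableT_comp.
  + by apply: measurable_funM => //; exact: (measurableT_comp m1).
  + by apply: measurable_funM => //; exact: (measurableT_comp m2).
- by move=> x; split; apply: (le_trans _ M4).
- move=> x h; rewrite /cubic_min.
  set y := b * (x - a).
  have -> : b * (x + h - a) = y + b * h by rewrite /y; ring.
  have [h1|/ltW h1] := leP `|h| 1.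
    have -> : Num.min (`|h| ^+ 3) (h ^+ 2) = `|h| ^+ 3.
      apply/min_idPl; rewrite -real_normK ?num_real// exprSr ler_piMr//.
    have := step_taylor y (b * h).
    rewrite normrM (gtr0_norm b0) [(b * `|h|) ^+ 3]exprMn => St.
    apply: le_trans (_ : _ <= 2 * (b ^+ 3 * `|h| ^+ 3)) _.
      rewrite (_ : _ - _ = step (y + b * h) - (step y + step1 y * (b * h) + step2 y * ((b * h) ^+ 2 / 2)))//.
      by ring.
    rewrite mulrA ler_wpM2r ?exprn_ge0// /M; lra.
  have hh : `|h| <= h ^+ 2 by rewrite -[h ^+ 2]real_normK ?num_real// expr2 ler_peMl.
  have -> : Num.min (`|h| ^+ 3) (h ^+ 2) = h ^+ 2.
    apply/min_idPr; rewrite -[h ^+ 2]real_normK ?num_real// [leRHS]exprSr ler_peMr//.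
  have hsq1 : 1 <= h ^+ 2 by exact: le_trans hh.
  have H1 : `|b * step1 y * h| <= M * h ^+ 2 by rewrite normrM ler_pM.
  have H2 : `|b ^+ 2 * step2 y * (h ^+ 2 / 2)| <= M * h ^+ 2.
    rewrite normrM ler_pM// ger0_norm ?divr_ge0 ?sqr_ge0//.
    by rewrite ler_pdivrMr// ler_peMr ?sqr_ge0//; lra.
  have S0 z : `|step z| <= M * h ^+ 2.
    by rewrite (le_trans (B0 z))// ler_peMr.
  rewrite (le_trans (ler_normB _ _))// (_ : 4 * M * h ^+ 2 = M * h ^+ 2 + (M * h ^+ 2 + M * h ^+ 2 + M * h ^+ 2)); last by ring.
  rewrite lerD// (le_trans (ler_normD _ _))// lerD// (le_trans (ler_normD _ _))// lerD//.
Qed.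

End smooth_step.

Section cdf_convergence.
Context (R : realType).

Definition rcdf d (T : measurableType d) (P : probability T R) (X : {RV P >-> R})
  (a : R) : R := fine (cdf X a).

Section one_variable.
Context d (T : measurableType d) (P : probability T R) (X : {RV P >-> R}).

Lemma rcdfE a : (rcdf X a)%:E = cdf X a.
Proof. by rewrite /rcdf fineK// fin_num_measure. Qed.

Let Rintegral_indic a : \int[P]_w (\1_`]-oo, a] (X w)) = rcdf X a.
Proof.
rewrite /rcdf /Rintegral; congr fine.
transitivity (\int[P]_w (\1_(X @^-1` `]-oo, a]) w)%:E)%E; first exact: eq_integral.
by rewrite integral_indic ?setIT//; exact: measurable_funPTI.
Qed.

Let integrable_indic a : P.-integrable setT (EFin \o (fun w => \1_`]-oo, a] (X w) : R)).
Proof.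
apply: (@integrable_ubound _ _ _ _ _ 1); first exact: measurableT_comp.
by move=> w; rewrite indicE; case: (_ \in _); rewrite ?normr1 ?normr0.
Qed.

Lemma rcdf_le_step a b : 0 < b -> rcdf X a <= \int[P]_w step (b * (X w - a)).
Proof.
move=> b0; have [K [g1 [g2 [[mg _ _] gK _]]]] := taylor_class_step a b0.
rewrite -Rintegral_indic; apply: le_Rintegral => //.
  apply: (@integrable_ubound _ _ _ _ _ K) => [|w]; first exact: (measurableT_comp mg).
  by have [] := gK (X w).
move=> w _; rewrite indicE; case: (boolP (_ \in _)) => h /=; last exact: step_ge0.
rewrite step_eq1//; move: h; rewrite inE/= in_itv/= => h.
by rewrite pmulr_rle0// subr_le0.
Qed.

Lemma step_le_rcdf a b : 0 < b -> \int[P]_w step (b * (X w - a)) <= rcdf X (a + 3 / b).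
Proof.
move=> b0; have [K [g1 [g2 [[mg _ _] gK _]]]] := taylor_class_step a b0.
rewrite -Rintegral_indic; apply: le_Rintegral => //.
  apply: (@integrable_ubound _ _ _ _ _ K) => [|w]; first exact: (measurableT_comp mg).
  by have [] := gK (X w).
move=> w _; rewrite indicE; case: (boolP (_ \in _)) => h /=; first exact: step_le1.
rewrite step_eq0//; move: h; rewrite notin_setE/= in_itv/= => /negP; rewrite -ltNge => h.
by rewrite mulrC -ler_pdivrMr// lerBrDl ltW.
Qed.

End one_variable.

Lemma rcdf_sandwich d (T : measurableType d) d' (T' : measurableType d')
    (P : probability T R) (Q : probability T' R)
    (S : nat -> {RV P >-> R}) (Z : {RV Q >-> R}) :
  (forall a b, 0 < b -> \int[P]_w step (b * (S n w - a)) @[n --> \oo] -->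
     \int[Q]_w step (b * (Z w - a))) ->
  forall a dl e, 0 < dl -> 0 < e ->
  (\forall n \near \oo, rcdf (S n) a <= rcdf Z (a + dl) + e) /\
  (\forall n \near \oo, rcdf Z (a - dl) - e <= rcdf (S n) a).
Proof.
move=> cv a dl e dl0 e0; have b0 : 0 < 3 / dl by rewrite divr_gt0.
have bdl : 3 / (3 / dl) = dl by field; rewrite gt_eqF.
split.
  have /cvgrPdist_le/(_ _ e0) := cv a _ b0; apply: filterS => n.
  have := rcdf_le_step (S n) a b0; have := step_le_rcdf Z a b0; rewrite bdl.
  by rewrite ler_norml => ? ? /andP[? ?]; lra.
have /cvgrPdist_le/(_ _ e0) := cv (a - dl) _ b0; apply: filterS => n.
have := rcdf_le_step Z (a - dl) b0; have := step_le_rcdf (S n) (a - dl) b0.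
by rewrite bdl subrK ler_norml => ? ? /andP[? ?]; lra.
Qed.

End cdf_convergence.

(** * Quantile coupling *)

Section quantile.
Context (R : realType).

(** Open upper half-lines form a generating class stable under intersection. *)
Lemma cdf_same_distribution d (T : measurableType d) d' (T' : measurableType d')
    (P : probability T R) (Q : probability T' R) (X : {RV P >-> R}) (Y : {RV Q >-> R}) :
  cdf X = cdf Y -> same_distribution X Y.
Proof.
move=> XY A mA.
apply: (@measure_unique _ R _ (@RGenOInfty.G R) (fun n => `]- n%:R, +oo[%classic)
  _ _ _ _ (distribution P X) (distribution Q Y)) => //.
- exact: RGenOInfty.measurableE.
- move=> _ _ [x ->] [y ->]; exists (Num.max x y); apply/seteqP.
  by split => z /=; rewrite !in_itv/= !andbT gt_max => /andP.
- by move=> n; exists (- n%:R).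
- apply/seteqP; split => // x _; have [n xn] := filter_ex (nbhs_infty_gtr (- x)).
  by exists n => //=; rewrite in_itv/= andbT ltrNl.
- by move=> _ [x ->]; rewrite -[LHS]/(ccdf X x) -[RHS]/(ccdf Y x) !ccdf_1_cdf XY.
- by move=> n; apply: (le_lt_trans (probability_le1 _ _)); rewrite ?ltry.
Qed.

Section one_variable.
Context d (T : measurableType d) (P : probability T R) (X : {RV P >-> R}).

Lemma rcdf_ge0 a : 0 <= rcdf X a.
Proof. by rewrite fine_ge0. Qed.

Lemma rcdf_le1 a : rcdf X a <= 1.
Proof. by rewrite -lee_fin rcdfE cdf_le1. Qed.

Lemma rcdf_nondecreasing : {homo rcdf X : a b / a <= b}.
Proof. by move=> a b ab; rewrite -lee_fin !rcdfE cdf_nondecreasing. Qed.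

Lemma rcdf_exists_gt u : u < 1 -> exists a, u < rcdf X a.
Proof.
move=> u1; have cv : rcdf X @ +oo --> (1 : R) by exact/fine_cvg/cvg_cdfy1.
have h : \forall a \near +oo, u < rcdf X a by exact: (cvgr_gt _ cv).
exact: filter_ex h.
Qed.

Lemma rcdf_exists_lt u : 0 < u -> exists a, rcdf X a < u.
Proof.
move=> u0; have cv : rcdf X @ -oo --> (0 : R) by exact/fine_cvg/cvg_cdfNy0.
have h : \forall a \near -oo, rcdf X a < u by exact: (cvgr_lt _ cv).
exact: filter_ex h.
Qed.

(** Right continuity, in the form that makes the infimum in [quantile] attained. *)
Lemma rcdf_lt_right u a : rcdf X a < u -> exists2 b, a < b & rcdf X b < u.
Proof.
move=> au; have cv : rcdf X x @[x --> a^'+] --> rcdf X a.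
  by apply: fine_cvg; rewrite rcdfE; exact: cdf_right_continuous.
have h : \forall x \near a^'+, rcdf X x < u by exact: (cvgr_lt _ cv).
have h2 : \forall x \near a^'+, a < x by exact: nbhs_right_gt.
by have [b []] := filter_ex (filterI h2 h); exists b.
Qed.

(* Outside of ]0, 1[ the value [0] is a dummy. *)
Definition quantile (u : R) : R :=
  if 0 < u < 1 then inf [set x | u <= rcdf X x] else 0.

Lemma quantile_le u x : 0 < u < 1 -> (quantile u <= x) = (u <= rcdf X x).
Proof.
move=> u01; rewrite /quantile u01; case/andP: u01 => u0 u1.
set A := [set x | _].
have An : A !=set0 by have [a /ltW ?] := rcdf_exists_gt u1; exists a.
have Ab : has_lbound A.
  have [a au] := rcdf_exists_lt u0; exists a => y; rewrite /A/= leNgt => uy.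
  by rewrite leNgt; apply: contra uy => /ltW/rcdf_nondecreasing/le_lt_trans; exact.
apply/idP/idP => [|ux]; last by apply: (ge_inf Ab).
apply: contraTT; rewrite -!ltNge => /rcdf_lt_right[b xb bu].
apply: (lt_le_trans xb); apply: lb_le_inf => // y; rewrite /A/= => uy.
by rewrite leNgt; apply: contraTN uy => /ltW/rcdf_nondecreasing/le_lt_trans; rewrite -ltNge; exact.
Qed.

Lemma quantile_preimage x :
  [set u | quantile u <= x] =
  [set u | (0 < u < 1) && (u <= rcdf X x)] `|` [set u | ~~ (0 < u < 1) && (0 <= x)].
Proof.
apply/seteqP; split => u /=.
  have [u01|u01] := boolP (0 < u < 1); first by rewrite quantile_le// => ?; left.
  by rewrite /quantile (negbTE u01) => ?; right.
case=> /andP[u01 ?]; first by rewrite quantile_le.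
by rewrite /quantile (negbTE u01).
Qed.

Lemma measurable_quantile : measurable_fun setT quantile.
Proof.
apply: (measurability (@RGenOInfty.G R)) => [|/= _ [_] [x] -> <-].
  exact: RGenOInfty.measurableE.
rewrite setTI (_ : _ @^-1` _ = ~` [set u | quantile u <= x]); last first.
  apply/seteqP; split => u /=; rewrite in_itv/= andbT.
    by rewrite ltNge => /negP.
  by move/negP; rewrite -ltNge.
apply: measurableC; rewrite quantile_preimage; apply: measurableU.
  rewrite (_ : [set u | _] = `]0, 1[ `&` `]-oo, rcdf X x]); first exact: measurableI.
  by apply/seteqP; split => u /=; rewrite !in_itv/= => /andP.
have [x0|x0] := boolP (0 <= x).
  rewrite (_ : [set u | _] = ~` `]0, 1[); first exact: measurableC.
  by apply/seteqP; split => u /=; rewrite in_itv/= andbT => /negP.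
rewrite (_ : [set u | _] = set0)//.
by apply/seteqP; split => u //=; rewrite andbF.
Qed.

Definition quantile_mfun : {mfun measurableTypeR R >-> R} :=
  mfun_of (measurable_quantile : measurable_fun (setT : set (measurableTypeR R)) quantile).

Local Notation lambda := (uniform_prob (@ltr01 R)).

Lemma uniform_prob01E (A : set R) : measurable A ->
  lambda A = lebesgue_measure (A `&` `[0, 1]).
Proof.
move=> mA; rewrite /uniform_prob integral_uniform_pdf.
rewrite (eq_integral (cst 1%E)); last first.
  move=> x; rewrite inE/= in_itv/= => -[_ x01].
  by rewrite /uniform_pdf x01 subr0 invr1.
by rewrite integral_cst ?mul1e//; exact: measurableI.
Qed.

(** By [quantile_le] the preimage of the half-line agrees with the interval from 0 to [rcdf X x] up
    to the points 0 and 1, where the dummy value intervenes; these are null. *)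
Lemma cdf_quantile : cdf (quantile_mfun : {RV lambda >-> R}) = cdf X.
Proof.
apply/funext => x; rewrite -[RHS]rcdfE -[LHS]/(lambda (quantile @^-1` `]-oo, x])).
have mq : measurable (quantile @^-1` `]-oo, x]).
  by rewrite -[_ @^-1` _]setTI; exact: measurable_quantile.
have F0 := rcdf_ge0 x; have F1 := rcdf_le1 x.
rewrite uniform_prob01E//; apply/eqP; rewrite eq_le; apply/andP; split.
- apply: (@le_trans _ _ (lebesgue_measure (`[0, rcdf X x] `|` [set 1]))).
    apply: le_measure; rewrite ?inE//; [exact: measurableI|exact: measurableU|].
    move=> u /= []; rewrite !in_itv/= => qx /andP[u0 u1].
    have [->|uN1] := eqVneq u 1; first by right.
    left; rewrite u0/=; have [->|uN0] := eqVneq u 0; first exact: F0.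
    by rewrite -quantile_le// !lt_neqAle eq_sym uN0 u0 uN1.
  rewrite (le_trans (measureU2 _ _ _))//= lebesgue_measure_set1 adde0.
  rewrite lebesgue_measure_itv/= lte_fin; case: ifP => _; last by rewrite lee_fin.
  by rewrite -EFinB subr0.
- apply: (@le_trans _ _ (lebesgue_measure `]0, rcdf X x[)).
    rewrite lebesgue_measure_itv/= lte_fin; case: ltP => h; last by rewrite lee_fin.
    by rewrite -EFinB subr0.
  apply: le_measure; rewrite ?inE//; first exact: measurableI.
  move=> u /=; rewrite !in_itv/= => /andP[u0 uF].
  have u1 : u < 1 by exact: lt_le_trans F1.
  by rewrite quantile_le ?u0 ?u1//; split; [exact: ltW|rewrite !ltW].
Qed.

End one_variable.

(** Strict growth of the limit distribution function leaves a positive gap between the level [u] and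
    its values at [q - e / 2] and [q + e / 2], and the approximation errors are chosen to fit in
    these gaps. *)
Lemma cvg_quantile d (T : measurableType d) d' (T' : measurableType d')
    (P : probability T R) (Q : probability T' R)
    (S : nat -> {RV P >-> R}) (Z : {RV Q >-> R}) :
  {homo rcdf Z : a b / a < b} ->
  (forall a dl e, 0 < dl -> 0 < e ->
    (\forall n \near \oo, rcdf (S n) a <= rcdf Z (a + dl) + e) /\
    (\forall n \near \oo, rcdf Z (a - dl) - e <= rcdf (S n) a)) ->
  forall u, quantile (S n) u @[n --> \oo] --> quantile Z u.
Proof.
move=> incF SZ u.
have [u01|u01] := boolP (0 < u < 1); last first.
  by rewrite /quantile (negbTE u01); exact: cvg_cst.
apply/cvgrPdist_le => e e0; set q := quantile Z u.
have e2 : 0 < e / 2 by rewrite divr_gt0.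
have uq : u <= rcdf Z q by rewrite -quantile_le.
have qr : rcdf Z q < rcdf Z (q + e / 2) by apply: incF; rewrite ltrDl.
have ql : rcdf Z (q - e / 2) < u.
  by rewrite ltNge -quantile_le// -/q -ltNge ltrBlDr ltrDl.
have [_ up] := SZ (q + e) (e / 2) (rcdf Z (q + e / 2) - u) e2 ltac:(lra).
(* The lower gap is halved because [rcdf (S n) (q - e) < u] has to be strict. *)
have [lo _] := SZ (q - e) (e / 2) ((u - rcdf Z (q - e / 2)) / 2) e2 ltac:(lra).
near=> n.
have upn : rcdf Z (q + e - e / 2) - (rcdf Z (q + e / 2) - u) <= rcdf (S n) (q + e) by near: n.
have lon : rcdf (S n) (q - e) <= rcdf Z (q - e + e / 2) + (u - rcdf Z (q - e / 2)) / 2 by near: n.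
have E1 : q + e - e / 2 = q + e / 2 by lra.
have E2 : q - e + e / 2 = q - e / 2 by lra.
rewrite E1 in upn; rewrite E2 in lon.
have h1 : quantile (S n) u <= q + e by rewrite quantile_le//; lra.
have h2 : q - e < quantile (S n) u by rewrite ltNge quantile_le// -ltNge; lra.
by rewrite ler_norml; lra.
Unshelve. all: by end_near. Qed.

Lemma normal_rcdf_increasing d (T : measurableType d) (Q : probability T R)
    (Z : {RV Q >-> R}) (s : R) : 0 < s -> is_normal 0 s Z ->
  {homo rcdf Z : a b / a < b}.
Proof.
move=> s0 nZ a b ab; rewrite -lte_fin !rcdfE /cdf !nZ//.
have -> : `]-oo, b]%classic = `]-oo, a]%classic `|` `]a, b]%classic.
  by rewrite -itv_bndbnd_setU// bnd_simp ltW.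
rewrite measureU//; last first.
  apply/seteqP; split => // x /=; rewrite !in_itv/= => -[xa /andP[ax _]].
  by move: ax; rewrite ltNge xa.
(* This bound holds whatever the signs of [a] and [b], and gives a positive lower bound [c] of the
   density on []a, b]]. *)
have sq_le (y : R) : a < y -> y <= b -> y ^+ 2 <= a ^+ 2 + b ^+ 2.
  by move=> ay yb; have [y0|y0] := leP 0 y; nra.
have sN0 : s != 0 by rewrite gt_eqF.
pose c := normal_peak s * expR (- ((a ^+ 2 + b ^+ 2) / (s ^+ 2 *+ 2))).
have c0 : 0 < c by rewrite mulr_gt0 ?expR_gt0 ?normal_peak_gt0.
have fin : normal_prob 0 s `]-oo, a] \is a fin_num by rewrite fin_num_measure.
rewrite -[ltLHS]adde0 lteD2lE//.
apply: (@lt_le_trans _ _ (\int[lebesgue_measure]_(x in `]a, b]) c%:E)%E).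
  rewrite integral_cst//= lebesgue_measure_itv/= lte_fin ab -EFinB -EFinM lte_fin.
  by rewrite mulr_gt0// subr_gt0.
apply: ge0_le_integral => //.
- by move=> x _; rewrite lee_fin ltW.
- by apply/measurable_EFinP/measurable_funTS; exact: measurable_normal_pdf.
- move=> x /=; rewrite in_itv/= => /andP[ax xb].
  rewrite lee_fin normal_pdf0E// /c ler_wpM2l ?normal_peak_ge0// ler_expR lerN2.
  by rewrite ler_wpM2r ?sq_le// invr_ge0 pmulrn_lge0 ?sqr_ge0.
Qed.

End quantile.

(** * Passing to the limit *)

Section vitali.
Context d (T : measurableType d) (R : realType) (P : probability T R).

(** Continuous in [x], unlike a truncation by an indicator, so uniform integrability in this form
    passes to the limit by Fatou. *)
Definition excess (p K x : R) : R := Num.max (`|x| `^ p - K) 0.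

Lemma excess_ge0 p K x : 0 <= excess p K x.
Proof. by rewrite /excess le_max lexx orbT. Qed.

Lemma powR_le_excess p K x : `|x| `^ p <= excess p K x + K.
Proof. by rewrite -lerBlDr /excess le_max lexx. Qed.

Lemma measurable_excess p K : measurable_fun setT (excess p K).
Proof.
apply: measurable_maxr => //; apply: measurable_funB => //.
exact: measurable_norm_powR.
Qed.

(** Continuity is drawn from derivability of the power on the positive reals, so the limit 0 is
    treated apart. *)
Lemma cvg_norm_powR (u : R^nat) (l p : R) : 0 < p -> u n @[n --> \oo] --> l ->
  `|u n| `^ p @[n --> \oo] --> `|l| `^ p.
Proof.
move=> p0 ul; have [l0|l0] := eqVneq l 0.
  by rewrite l0 normr0 powR0 ?gt_eqF//; apply: cvg_norm_powR0; rewrite // -l0.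
have nl0 : 0 < `|l| by rewrite normr_gt0.
have dp : derivable (fun x : R => x `^ p) `|l| 1.
  by apply: derivable_powR; rewrite in_itv/= nl0.
move/derivable1_diffP/differentiable_continuous : dp => dp.
exact: (cvg_comp (fun n => `|u n|) (fun x => x `^ p) (cvg_norm ul) dp).
Qed.

Lemma cvg_excess p K (u : R^nat) (l : R) : 0 < p -> u n @[n --> \oo] --> l ->
  excess p K (u n) @[n --> \oo] --> excess p K l.
Proof.
move=> p0 ul; have a_cvg : `|u n| `^ p - K @[n --> \oo] --> `|l| `^ p - K.
  by apply: cvgB; [exact: cvg_norm_powR|exact: cvg_cst].
have maxE x : excess p K x = ((`|x| `^ p - K) + `|(`|x| `^ p - K)|) / 2.
  by rewrite /excess maxr_absE subr0 addr0.
rewrite maxE; under eq_cvg do rewrite maxE.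
by apply: cvgMl; apply: cvgD => //; exact: cvg_norm.
Qed.

Lemma fatou_le (f : nat -> T -> R) (g : T -> R) (e : \bar R) :
  (forall n, measurable_fun setT (f n)) -> (forall n x, 0 <= f n x) ->
  (forall x, f n x @[n --> \oo] --> g x) ->
  (forall n, \int[P]_x (f n x)%:E <= e)%E -> (\int[P]_x (g x)%:E <= e)%E.
Proof.
move=> mf f0 fg fe.
have mE n : measurable_fun setT (fun x => (f n x)%:E) by exact/measurable_EFinP.
have := @fatou _ _ _ P setT measurableT (fun n x => (f n x)%:E) mE
  (fun n x _ => f0 n x : (0 <= (f n x)%:E)%E).
rewrite (eq_integral (fun x => (g x)%:E)); last first.
  move=> x _; have cv : (f n x)%:E @[n --> \oo] --> (g x)%:E.
    by apply: cvg_EFin; [exact: nearW|exact: fg].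
  rewrite is_cvg_limn_einfE; last by apply/cvg_ex; exists (g x)%:E.
  exact: cvg_lim.
move/le_trans; apply; rewrite limn_einf_lim; apply: lime_le; first exact: is_cvg_einfs.
apply: nearW => n; apply: le_trans (fe n).
by apply: ereal_inf_lbound; exists n => /=.
Qed.

(** The difference is cut at a level [C]: the bounded part tends to 0 by dominated convergence, and
    what exceeds it is controlled by the excesses of [A n] and, through Fatou, of [B]. *)
Lemma vitali_powR (p : R) (A : nat -> T -> R) (B : T -> R) : 0 < p ->
  (forall n, measurable_fun setT (A n)) -> measurable_fun setT B ->
  (forall x, A n x @[n --> \oo] --> B x) ->
  (forall e, 0 < e -> exists2 K, 0 <= K &
    forall n, (\int[P]_x (excess p K (A n x))%:E <= e%:E)%E) ->
  forall e, 0 < e ->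
    \forall n \near \oo, (\int[P]_x (`|A n x - B x| `^ p)%:E <= e%:E)%E.
Proof.
move=> p0 mA mB AB UI e e0.
have tp0 : 0 < 2 `^ p :> R by exact: powR_gt0.
pose dl := e / 2 / (2 `^ p * 2).
have dl0 : 0 < dl by rewrite !divr_gt0// mulr_gt0.
have [K K0 UK] := UI _ dl0.
have mexA n : measurable_fun setT (fun x => excess p K (A n x)).
  exact: (measurableT_comp (measurable_excess p K)).
have mexB : measurable_fun setT (fun x => excess p K (B x)).
  exact: (measurableT_comp (measurable_excess p K)).
have UB : (\int[P]_x (excess p K (B x))%:E <= dl%:E)%E.
  apply: (fatou_le mexA _ _ UK); first by move=> n x; exact: excess_ge0.
  by move=> x; exact: cvg_excess.
pose C : R := 2 `^ p * (K + K).
have C0 : 0 <= C by rewrite mulr_ge0 ?(ltW tp0)// addr_ge0.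
pose m n x := Num.min (`|A n x - B x| `^ p) C.
have mm n : measurable_fun setT (m n).
  apply: measurable_minr => //; apply: measurable_norm_powR; exact: measurable_funB.
have m0 n x : 0 <= m n x by rewrite /m le_min powR_ge0.
have mC n x : `|m n x| <= C by rewrite ger0_norm// /m ge_min lexx orbT.
have mi n : P.-integrable setT (EFin \o m n) by exact: integrable_ubound (mC n).
have mcv : \int[P]_x m n x @[n --> \oo] --> (0 : R).
  rewrite -(Rintegral_cstT P 0).
  apply: (Rintegral_dominated_cvg (g := fun=> C)) => //; last exact: integrable_cstR.
  apply: aeW => x.
  have h : `|A n x - B x| `^ p @[n --> \oo] --> (0 : R).
    apply: cvg_norm_powR0 => //; rewrite -(subrr (B x)).
    by apply: cvgB; [exact: AB|exact: cvg_cst].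
  apply: (squeeze_cvgr _ (cvg_cst 0) h); apply: nearW => n.
  by rewrite m0/= /m ge_min lexx.
have bound n x : `|A n x - B x| `^ p <=
    m n x + 2 `^ p * (excess p K (A n x) + excess p K (B x)).
  have ex0 : 0 <= 2 `^ p * (excess p K (A n x) + excess p K (B x)).
    by rewrite mulr_ge0 ?addr_ge0 ?excess_ge0// ltW.
  have [h|h] := leP (`|A n x - B x| `^ p) C; first by rewrite /m (min_idPl h) lerDl.
  rewrite /m (min_idPr (ltW h)).
  rewrite /C -mulrDr (le_trans (powR_normD _ _ (ltW p0)))// ler_wpM2l ?(ltW tp0)// normrN.
  by have := powR_le_excess p K (A n x); have := powR_le_excess p K (B x); lra.
have e2 : 0 < e / 2 by rewrite divr_gt0.
move/cvgrPdist_le : mcv => /(_ _ e2); apply: filterS => n.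
rewrite sub0r normrN ger0_norm; last by apply: Rintegral_ge0.
move=> mn.
apply: (@le_trans _ _ (\int[P]_x ((m n x)%:E +
   (2 `^ p)%:E * ((excess p K (A n x))%:E + (excess p K (B x))%:E)))%E).
  apply: ge0_le_integral => //.
  - by apply/measurable_EFinP; apply: measurable_norm_powR; exact: measurable_funB.
  - apply/measurable_EFinP; apply: measurable_funD => //.
    by apply: measurable_funM => //; exact: measurable_funD.
  - by move=> x _; have := bound n x; rewrite -lee_fin !(EFinD, EFinM).
rewrite ge0_integralD//; last 4 first.
- by move=> x _; rewrite lee_fin.
- exact/measurable_EFinP.
- by move=> x _; rewrite -EFinD -EFinM lee_fin mulr_ge0 ?addr_ge0 ?excess_ge0// ltW.
- by apply/measurable_EFinP; apply: measurable_funM => //; exact: measurable_funD.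
rewrite ge0_integralZl//; last 2 first.
- by apply: emeasurable_funD; exact/measurable_EFinP.
- by move=> x _; rewrite -EFinD lee_fin addr_ge0 ?excess_ge0.
rewrite ge0_integralD//; last 4 first.
- by move=> x _; rewrite lee_fin excess_ge0.
- exact/measurable_EFinP.
- by move=> x _; rewrite lee_fin excess_ge0.
- exact/measurable_EFinP.
rewrite -(EFin_Rintegral (mi n)).
apply: (@le_trans _ _ ((e / 2)%:E + (2 `^ p)%:E * (dl%:E + dl%:E))%E).
  rewrite leeD ?lee_fin// lee_pmul2l ?lte_fin//.
  exact: leeD (UK n) UB.
rewrite -(EFinD dl) -EFinM -EFinD lee_fin /dl le_eqVlt; apply/orP; left; apply/eqP.
by field; rewrite gt_eqF.
Qed.

End vitali.

(** * From the quantile coupling to the Mallows distance *)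

Section mallows_bound.
Context (R : realType) d (T : measurableType d) (P : probability T R)
  d' (T' : measurableType d') (Q : probability T' R).

Lemma mallows_ge0 (r : R) (X : {RV P >-> R}) (Y : {RV Q >-> R}) :
  (0 <= mallows r X Y)%E.
Proof. exact: poweR_ge0. Qed.

Lemma mallows_le_quantile (r e : R) (X : {RV P >-> R}) (Y : {RV Q >-> R}) :
  0 < r -> 0 < e ->
  (\int[uniform_prob (@ltr01 R)]_u (`|quantile X u - quantile Y u| `^ r)%:E <=
    (e `^ r)%:E)%E ->
  (mallows r X Y <= e%:E)%E.
Proof.
move=> r0 e0 h.
rewrite /mallows /mallows_dist; set I := ereal_inf _.
have Ile : (I <= (e `^ r)%:E)%E.
  apply: le_trans h; apply: ereal_inf_lbound.
  exists _, (measurableTypeR R), (uniform_prob (@ltr01 R)),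
    (quantile_mfun X), (quantile_mfun Y).
  by split; [exact: cdf_quantile|exact: cdf_quantile|rewrite unlock].
have I0 : (0 <= I)%E.
  apply: le_ereal_inf_tmp => _ [d1 [T1 [P1 [X1 [Y1 [_ _ ->]]]]]].
  by apply: expectation_ge0 => w; exact: powR_ge0.
apply: (@le_trans _ _ ((e `^ r)%:E `^ r^-1)%E).
  have r1 : 0 <= r^-1 by rewrite invr_ge0 ltW.
  apply: (gt0_ler_poweR r1) => //; first by rewrite in_itv/= I0 leey.
  by rewrite in_itv/= leey lee_fin powR_ge0.
by rewrite poweR_EFin -powRrM mulfV ?gt_eqF// powRr1// ltW.
Qed.

End mallows_bound.

Local Open Scope ereal_scope.

Theorem theorem3p2 (R : realType) (d : measure_display) (T : measurableType d)
  (P : probability T R) (X : nat -> {RV P >-> R})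
  (d' : measure_display) (T' : measurableType d') (Q : probability T' R)
  (Z : {RV Q >-> R}) (r sigma : R)
  (Xiid : iid X)
  (meanX : 'E_P[X 0%N] = 0)
  (sigma_gt0 : (0 < sigma)%R)
  (varX : 'V_P[X 0%N] = (sigma ^+ 2)%:E)
  (r_ge2 : (2 <= r)%R)
  (momentX : 'E_P[fun w => (`|X 0%N w| `^ r)%R] < +oo)
  (normalZ : is_normal 0%R sigma Z) :
  mallows r (normalized_sum X n) Z @[n --> \oo] --> 0.
Proof.
have r_gt0 : (0 < r)%R by lra.
have Xr : P.-integrable setT (EFin \o (fun w => (`|X 0%N w| `^ r)%R)).
  apply/ge0_integrableP => [|w|]; [exact: measurable_norm_powR|exact: powR_ge0|].
  by move: momentX; rewrite unlock.
have EX : (\int[P]_w X 0%N w = 0)%R by move: meanX; rewrite unlock /Rintegral => ->.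
have EX2 : \int[P]_w (X 0%N w ^+ 2)%:E = (sigma ^+ 2)%:E.
  rewrite -varX /variance unlock meanX unlock; apply: eq_integral => w _.
  by rewrite -[RHS]/(((X 0%N w - 0) * (X 0%N w - 0))%R)%:E subr0 expr2.
have X2 : P.-integrable setT (EFin \o (fun w => (X 0%N w ^+ 2)%R)).
  apply/ge0_integrableP => [|w|]; [exact: measurable_funX|exact: sqr_ge0|].
  by rewrite EX2 ltry.
have VX : (\int[P]_w (X 0%N w ^+ 2) = sigma ^+ 2)%R by rewrite /Rintegral EX2.
pose S n : {RV P >-> R} := normalized_sum X n.
have SE n w : S n w = (psum X n w / Num.sqrt n%:R)%R.
  by rewrite psumE.
have clt a b : (0 < b)%R -> (\int[P]_w step (b * (S n w - a)))%R @[n --> \oo] -->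
    (\int[Q]_w step (b * (Z w - a)))%R.
  move=> b0; have [K [g1 [g2 Kg]]] := taylor_class_step a b0.
  have := cvg_taylor_expectation sigma_gt0 normalZ Xiid X2 EX VX Kg
    (fun y => step_ge0 (b * (y - a))).
  apply: cvg_trans; apply: near_eq_cvg; apply: nearW => n.
  by apply: eq_Rintegral => w _; rewrite SE.
have qcvg := cvg_quantile (normal_rcdf_increasing sigma_gt0 normalZ) (rcdf_sandwich clt).
have UI e : (0 < e)%R -> exists2 K : R, (0 <= K)%R & forall n,
    \int[uniform_prob (@ltr01 R)]_u (excess r K (quantile (S n) u))%:E <= e%:E.
  move=> e0; have [K K0 HK] := psum_uniform_integrable r_ge2 Xiid Xr EX e0.
  have [D D0 HD] := psum_normalized_powR_le P r_ge2.
  exists K => // n.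
  (* The mean of the excess depends on the law only, so the bound for [S n] holds for its quantile
     function. *)
  have same : same_distribution (quantile_mfun (S n) :
      {RV uniform_prob (@ltr01 R) >-> R}) (S n).
    by apply: cdf_same_distribution; exact: cdf_quantile.
  rewrite (same_distribution_ge0_integral same (h := fun x => (excess r K x)%:E)); last 2 first.
  - by apply/measurable_EFinP; exact: measurable_excess.
  - by move=> x; rewrite lee_fin excess_ge0.
  have [Sr _] := HD X Xiid Xr EX n.
  rewrite -(EFin_Rintegral (f := fun w => excess r K (S n w))); last first.
    apply: integrable_dominated Sr.
      by apply: (measurableT_comp (measurable_excess r K)).
    move=> w; rewrite ger0_norm ?excess_ge0// -SE /excess ge_max powR_ge0 andbT.
    by rewrite lerBlDr lerDl.
  have -> : (\int[P]_w excess r K (S n w) =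
      \int[P]_w Num.max (`|psum X n w / Num.sqrt n%:R| `^ r - K) 0)%R.
    by apply: eq_Rintegral => w _; rewrite /excess SE.
  by rewrite lee_fin; exact: HK.
have close e : (0 < e)%R -> \forall n \near \oo, mallows r (S n) Z <= e%:E.
  move=> e0; have er0 : (0 < e `^ r)%R by exact: powR_gt0.
  have := @vitali_powR _ _ R (uniform_prob (@ltr01 R)) r (fun n => quantile (S n))
    (quantile Z) r_gt0 (fun n => measurable_quantile (S n)) (measurable_quantile Z)
    qcvg UI _ er0.
  by apply: filterS => n; exact: mallows_le_quantile.
(* The distance takes values in the extended reals: [close] at 1 makes it eventually finite, and the
   limit is then a real one. *)
apply/fine_cvgP; split.
  have := close _ ltr01; apply: filterS => n h.
  by rewrite ge0_fin_numE ?mallows_ge0// (le_lt_trans h)// ltry.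
apply/cvgrPdist_le => e e0; have := close _ e0; apply: filterS => n h.
rewrite sub0r normrN /= ger0_norm ?fine_ge0 ?mallows_ge0//.
rewrite -lee_fin fineK// ge0_fin_numE ?mallows_ge0//.
by rewrite (le_lt_trans h)// ltry.
Qed.
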